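(* Let $d, D \in \mathbb{N}$ and $\epsilon > 0$. Let $\{\alpha_n\}_{n\ge 1}$ be a sequence of algebraic integers such that: (i) $\max_n \deg \alpha_n = d$; (ii) $|\alpha_n| = \overline{|\alpha_n|}$ for every $n$, i.e. $\alpha_n$ has maximal modulus among its conjugates; (iii) $|\alpha_n|$ is non-decreasing in $n$; (iv) $|\alpha_n| \ge n^{1+\epsilon}$ for all sufficiently large $n$; (v) either $\mathrm{Re}(\alpha_n) > 0$ for all $n$, or $\mathrm{Im}(\alpha_n) > 0$ for all $n$; (vi) $\displaystyle \limsup_{n \to \infty} \overline{|\alpha_n|}^{\,1/\left(D^n \prod_{i=1}^{n-1}(d^i + d)\right)} = \infty.$ Then $$\deg\left(\sum_{n=1}^\infty \frac{1}{\alpha_n}\right) > D.$$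
   Context: For an algebraic number $\alpha$, the house $\overline{|\alpha|}$ is the maximum of $|\alpha'|$ over all complex conjugates $\alpha'$ of $\alpha$. The degree of an algebraic number is the degree of its minimal polynomial over $\mathbb{Q}$; the degree of a transcendental number is defined to be $\infty$. The empty product (for $n=1$) equals $1$. *)

(* Defs.v *)
From Stdlib Require Import Reals List Lia.
Open Scope R_scope.

Definition Cx : Type := (R * R)%type.
Definition Cre (z : Cx) : R := fst z.
Definition Cim (z : Cx) : R := snd z.
Definition Cadd (z w : Cx) : Cx := (fst z + fst w, snd z + snd w).
Definition Cmul (z w : Cx) : Cx :=
  (fst z * fst w - snd z * snd w, fst z * snd w + snd z * fst w).
Definition Cnorm (z : Cx) : R := sqrt (fst z * fst z + snd z * snd z).
Definition Cinv (z : Cx) : Cx :=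
  let n2 := fst z * fst z + snd z * snd z in (fst z / n2, - snd z / n2).
Definition ZtoC (c : Z) : Cx := (IZR c, 0).

(* Polynomials with integer coefficients: list of coefficients, constant first.
   The degree of p is at most (length p - 1). *)
Definition peval (p : list Z) (z : Cx) : Cx :=
  fold_right (fun c acc => Cadd (ZtoC c) (Cmul z acc)) (0, 0) p.
Definition pnonzero (p : list Z) : Prop := Exists (fun c => c <> 0%Z) p.
Definition proot (p : list Z) (z : Cx) : Prop := peval p z = (0, 0).

Definition alg_integer (z : Cx) : Prop :=
  exists p : list Z, last p 0%Z = 1%Z /\ proot p z.

(* [alg_deg z k]: z is algebraic of degree k, i.e. k is the least degree of a
   nonzero polynomial over Q (equivalently, after clearing denominators, over Z)
   vanishing at z. *)
Definition alg_deg (z : Cx) (k : nat) : Prop :=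
  (exists p, pnonzero p /\ length p = S k /\ proot p z) /\
  (forall p, pnonzero p -> (length p <= k)%nat -> ~ proot p z).

(* deg z > D, with the convention deg = infinity for transcendental z. *)
Definition deg_gt (z : Cx) (D : nat) : Prop :=
  ~ (exists k, (k <= D)%nat /\ alg_deg z k).

(* beta is a conjugate of alpha: beta is a root of the minimal polynomial of
   alpha (any nonzero integer polynomial of minimal degree vanishing at alpha
   is a scalar multiple of the minimal polynomial). *)
Definition conjugate (alpha beta : Cx) : Prop :=
  exists k p, alg_deg alpha k /\ pnonzero p /\ length p = S k /\
              proot p alpha /\ proot p beta.

Definition house (alpha : Cx) (h : R) : Prop :=
  (exists beta, conjugate alpha beta /\ Cnorm beta = h) /\
  (forall beta, conjugate alpha beta -> Cnorm beta <= h).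

Definition prodterm (d n : nat) : nat :=
  fold_right Nat.mul 1%nat (map (fun i => (d ^ i + d)%nat) (seq 1 (n - 1))).

(* Main.v *)
(** Suppose the sum s has degree at most D, and put P_N = |alpha_1 ... alpha_N|.
    Up to a bounded factor per conjugate, the number
    alpha_1 ... alpha_N (s - sum_(n <= N) 1/alpha_n) is an algebraic integer
    which is nonzero by (v); its conjugates lie among the at most D d^N values
    obtained by choosing conjugates of s and of the alpha_n independently, and
    by (ii) they are all at most C P_N.  As the product of the nonzero values
    is a nonzero integer up to that factor, the tail T_N = sum_(n > N) 1/|alpha_n|
    satisfies T_N >= (C P_N)^(- D d^N) for all N.

    Call step N good if T_N is essentially 1/|alpha_(N+1)|, up to a factor
    log |alpha_(N+1)|.  At a good step the lower bound gives
    log P_(N+1) <= (1 + D d^N) log P_N + small error, so along good steps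
    log P_N / E_N stays bounded, where E_N = D^N prod_(i<N) (d^i + d).
    If |alpha_n| > 2^n eventually, then all late steps are good, against (vi).
    Otherwise take t with |alpha_t| <= 2^t, so that log P_t / E_t is tiny, and
    then k > t with log |alpha_k| > E_k and |alpha_n| > 2^n in between.
    By (iv) the tail at k is at most |alpha_k|^(-delta), hence steps
    are good until P_N^(D d^N) reaches |alpha_k|^delta; this
    forces log |alpha_k| to be a small multiple of E_k, a contradiction. *)

Require Import Defs.
From mathcomp Require all_boot all_order all_algebra perm mpoly ring complex Rstruct ssrZ.
From Stdlib Require Import Reals List ZArith Arith Lia Lra IndefiniteDescription Classical.
Open Scope R_scope.

Fixpoint prod_lt (f : nat -> R) (n : nat) : R :=
  match n with O => 1 | S m => prod_lt f m * f m end.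

Fixpoint sum_lt (f : nat -> R) (n : nat) : R :=
  match n with O => 0 | S m => sum_lt f m + f m end.

Fixpoint Csum_lt (f : nat -> Cx) (n : nat) : Cx :=
  match n with O => (0, 0) | S m => Cadd (Csum_lt f m) (f m) end.

Definition Csub (z w : Cx) : Cx := (fst z - fst w, snd z - snd w).

Module Liouville.

Import all_boot all_order all_algebra perm mpoly ring complex Rstruct ssrZ.
Set Implicit Arguments. Unset Strict Implicit. Unset Printing Implicit Defensive.
Import Order.TTheory GRing.Theory Num.Theory.
Local Open Scope ring_scope.

(** * Products over all choices of conjugates *)

Lemma symmetric_prod_horner (S : comNzRingType) n (f : {poly S}) :
  \prod_(i < n) (map_poly (@mpolyC n S) f).['X_i] \is symmetric.
Proof.
apply/issymP => s; rewrite rmorph_prod /=.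
rewrite [RHS](reindex_inj (@perm_inj _ s)) /=; apply: eq_bigr => i _.
rewrite -horner_map /= msymX -map_poly_comp.
congr (_.[_]).
  by apply: eq_map_poly => c /=; rewrite -alg_mpolyC linearZ /= msym1.
congr 'X_[_]; apply/mnmP => k; rewrite !mnmE.
by rewrite -(inj_eq (@perm_inj _ s) i) permKV.
Qed.

(** The product is symmetric in the roots, hence a polynomial over S in their elementary symmetric
    functions, which are up to sign the integer coefficients of [p]. *)
Lemma prod_horner_roots (S : comNzRingType) (L : idomainType)
    (j : {rmorphism S -> L}) (p : {poly int}) (rs : seq L) (f : {poly S}) :
  map_poly intr p = \prod_(r <- rs) ('X - r%:P) ->
  exists e, j e = \prod_(r <- rs) (map_poly j f).[r].
Proof.
move=> pE; set n := size rs; pose r : n.-tuple L := in_tuple rs.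
have [t [tE _]] := sym_fundamental (symmetric_prod_horner n f).
(* By Vieta, [j (v k)] is the elementary symmetric function of degree k + 1 of the roots. *)
pose v (k : 'I_n) : S := (-1) ^+ k.+1 * (p`_(n - k.+1))%:~R.
exists t.@[v].
transitivity (mmap j (tnth r) (\prod_(i < n) (map_poly (@mpolyC n S) f).['X_i])).
  rewrite -tE comp_mpolyEX mevalE !rmorph_sum /=; apply: eq_bigr => m _.
  rewrite rmorphM mmapZ /=; congr (_ * _).
  rewrite comp_mpolyX rmorph_prod rmorph_prod /=; apply: eq_bigr => i _.
  rewrite !rmorphXn /=; congr (_ ^+ _).
  rewrite tnth_mktuple /v rmorphM rmorphXn rmorphN1 rmorph_int /=.
  have -> : (p`_(n - i.+1))%:~R = (map_poly intr p)`_(n - i.+1) :> L.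
    by rewrite coef_map.
  have ik : (i.+1 < n.+1)%N by rewrite ltnS.
  rewrite pE (mroots_coeff r (Ordinal ik)) mulrA -expr2 -exprM mulnC exprM sqrrN !expr1n mul1r.
  rewrite /mesym !raddf_sum /=; apply: eq_bigr => h _.
  rewrite !rmorph_prod /=.
  by apply: eq_bigr => l _; rewrite mmapX mmap1U mevalXU.
rewrite rmorph_prod [RHS]big_tnth; apply: eq_bigr => i _ /=.
rewrite -horner_map /= mmapX mmap1U -map_poly_comp.
by congr _.[_]; apply: eq_map_poly => c /=; rewrite mmapC.
Qed.

Lemma prodr_const_seq (R : pzSemiRingType) (I : Type) (r : seq I) (x : R) :
  \prod_(i <- r) x = x ^+ size r.
Proof. by rewrite big_const_seq count_predT; elim: size => //= n ->; rewrite exprS. Qed.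

(* For S = Z[X], x = 0, y = -1, z = X this says that
   c * prod_W (X - w.2) has integer coefficients.  The quantification over all
   rings is what makes the property stable under [extend_pairs]: conjugates of
   the new number are adjoined by passing from S to S[X]. *)
Definition int_form (C : numClosedFieldType) (c : int) (W : seq (C * C)) : Prop :=
  forall (S : comNzRingType) (L : idomainType)
    (j : {rmorphism S -> L}) (i : {rmorphism C -> L}) (x y z : S),
  exists e, j e = c%:~R * \prod_(w <- W) (j z + j x * i w.1 + j y * i w.2).

(* If (w.1, w.2) = (A, A (s - sigma)), the new pair is
   (A b, A b (s - sigma - 1/b)). *)
Definition extend_pairs (C : numClosedFieldType) (rs : seq C) (W : seq (C * C)) :=
  [seq (w.1 * b, w.2 * b - w.1) | b <- rs, w <- W].

(** With an indeterminate X in place of b, the factor of the pair extended from [w] is z + (x X - y)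
    w.1 + y X w.2. The hypothesis over S[X] thus yields a polynomial f, and [prod_horner_roots]
    multiplies its values at all b; each root contributes one factor [c]. *)
Lemma int_form_extend (C : numClosedFieldType) c W (p : {poly int}) (rs : seq C) :
  map_poly intr p = \prod_(r <- rs) ('X - r%:P) ->
  int_form c W -> int_form (c ^+ size rs) (extend_pairs rs W).
Proof.
move=> pE HW S L j i x y z.
have [f fE] := HW _ _ (map_poly j : {rmorphism {poly S} -> {poly L}})
  (polyC \o i : {rmorphism C -> {poly L}})
  (x *: 'X - y%:P) (y *: 'X) z%:P.
have pE' : map_poly intr p = \prod_(r <- map i rs) ('X - r%:P).
  have -> : map_poly intr p = map_poly i (map_poly intr p).
    by rewrite -map_poly_comp; apply: eq_map_poly => n /=; rewrite rmorph_int.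
  rewrite pE rmorph_prod big_map; apply: eq_bigr => r _.
  by rewrite rmorphB /= map_polyX map_polyC.
have [e eE] := prod_horner_roots j f pE'.
exists e; rewrite eE big_map /extend_pairs big_allpairs_dep.
rewrite rmorphXn /= -prodr_const_seq -big_split /=; apply: eq_bigr => b _.
rewrite /= in fE; rewrite fE hornerM horner_prod -(rmorph_int polyC) hornerC.
congr (_ * _); apply: eq_bigr => w _.
have -> : map_poly j (x *: 'X - y%:P) = j x *: 'X - (j y)%:P.
  by rewrite rmorphB /= map_polyZ map_polyX map_polyC.
rewrite (map_polyZ j) map_polyX map_polyC /= rmorphB !rmorphM /=.
by rewrite !(hornerD, hornerM, hornerZ, hornerN, hornerC, hornerX); ring.
Qed.

(** This is the homogenised value b^n P(a/b), n being the number of roots; induction on the roots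
    avoids dividing by b. *)
Lemma sum_coef_homog (L : comNzRingType) (ss : seq L) (a b : L) :
  \sum_(k < (size ss).+1)
    (\prod_(s <- ss) ('X - s%:P))`_k * a ^+ k * b ^+ (size ss - k) =
  \prod_(s <- ss) (a - b * s).
Proof.
elim: ss => [|s ss IH]; first by rewrite !big_nil big_ord1 coefC !mulr1.
rewrite !big_cons -IH /= mulr_sumr; set P := \prod_(_ <- ss) _; set n := size ss.
have Pn : P`_n.+1 = 0 by rewrite nth_default // size_prod_XsubC.
pose g k := P`_k * a ^+ k * b ^+ (n.+1 - k).
transitivity (\sum_(k < n.+2) (if k == 0 :> nat then 0 else P`_k.-1) * a ^+ k
                * b ^+ (n.+1 - k) - s * \sum_(k < n.+2) g k).
  rewrite mulr_sumr -sumrB; apply: eq_bigr => k _.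
  by rewrite mulrBl coefB coefXM coefCM /g !mulrBl !mulrA.
rewrite big_ord_recl /= !mul0r add0r [X in _ * X]big_ord_recr /= {2}/g Pn !mul0r addr0.
rewrite mulr_sumr -sumrB; apply: eq_bigr => k _.
have kn : (k <= n)%N by rewrite -ltnS.
rewrite /g /bump /= add1n subSS subSn // !exprS.
by ring.
Qed.

Lemma int_form_base (C : numClosedFieldType) (q : {poly int}) (ss : seq C) :
  map_poly intr q = (lead_coef q)%:~R *: \prod_(s <- ss) ('X - s%:P) ->
  int_form (lead_coef q) [seq (1, s) | s <- ss].
Proof.
move=> qE S L j i x y z.
have qE' : map_poly intr q = (lead_coef q)%:~R *: \prod_(s <- map i ss) ('X - s%:P).
  have -> : map_poly intr q = map_poly i (map_poly intr q).
    by rewrite -map_poly_comp; apply: eq_map_poly => n /=; rewrite rmorph_int.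
  rewrite qE map_polyZ rmorph_int rmorph_prod big_map; congr (_ *: _).
  by apply: eq_bigr => r _; rewrite rmorphB /= map_polyX map_polyC.
(* Times the leading coefficient, the product of the z + x + y s is the homogenised [q] at (z + x,
   -y), which has integer coefficients. *)
exists (\sum_(k < (size ss).+1) (q`_k)%:~R * (z + x) ^+ k * (- y) ^+ (size ss - k)).
transitivity ((lead_coef q)%:~R * \prod_(s <- map i ss) (j (z + x) - j (- y) * s)); last first.
  rewrite !big_map; congr (_ * _); apply: eq_bigr => s _ /=.
  by rewrite rmorph1 rmorphN rmorphD; ring.
rewrite -sum_coef_homog rmorph_sum mulr_sumr size_map; apply: eq_bigr => k _.
rewrite !rmorphM !rmorphXn rmorph_int !mulrA; congr (_ * _ * _).
by rewrite -coefZ -qE' coef_map.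
Qed.

(* The lowest nonzero coefficient of F is c times the product of the nonzero
   roots up to sign, and it is an integer. *)
Lemma nonzero_root_bound (C : numClosedFieldType) (F : {poly int}) (c : int)
    (bs : seq C) (K b0 : C) :
  map_poly intr F = c%:~R *: \prod_(b <- bs) ('X - b%:P) -> c != 0 ->
  1 <= K -> (forall b, b \in bs -> `|b| <= K) -> b0 \in bs -> b0 != 0 ->
  1 <= `|c%:~R| * `|b0| * K ^+ (size bs).-1.
Proof.
move=> FE c0 K1 Kb b0in b0n.
pose nz := [seq b <- bs | b != 0].
have PE : \prod_(b <- bs) ('X - b%:P) =
    'X^(count (pred1 0) bs) * \prod_(b <- nz) ('X - b%:P) :> {poly C}.
  rewrite (bigID (fun b => b == 0)) /= big_filter; congr (_ * _).
  rewrite -big_filter -[in RHS]size_filter -prodr_const_seq big_seq [RHS]big_seq.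
  by apply: eq_bigr => b; rewrite mem_filter => /andP[/eqP-> _]; rewrite subr0.
set m := count _ _ in PE.
have coefF : (F`_m)%:~R = c%:~R * \prod_(b <- nz) (- b) :> C.
  rewrite -coef_map FE PE coefZ coefXnM ltnn subnn; congr (_ * _).
  rewrite -horner_coef0 horner_prod; apply: eq_bigr => b _.
  by rewrite hornerXsubC sub0r.
have b0nz : b0 \in nz by rewrite mem_filter b0n.
have : 1 <= `|(F`_m)%:~R : C|.
  rewrite -intr_norm -[1]/(1%:~R) ler_int -gtz0_ge1 normr_gt0.
  rewrite -(intr_eq0 C) coefF mulf_neq0 ?intr_eq0 //.
  rewrite prodf_seq_neq0; apply/allP => b; rewrite mem_filter /= oppr_eq0.
  by case/andP.
rewrite coefF normrM => /le_trans; apply; rewrite -mulrA ler_wpM2l //.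
rewrite (perm_big _ (perm_to_rem b0nz)) big_cons normrM normrN ler_wpM2l //.
rewrite normr_prod.
apply: (@le_trans _ _ (K ^+ size (rem b0 nz))).
  rewrite -prodr_const_seq big_seq [leRHS]big_seq; apply: ler_prod => b bin.
  have /mem_rem := bin; rewrite mem_filter => /andP[_ binbs].
  by rewrite normr_ge0 normrN Kb.
rewrite ler_weXn2l // size_rem // -!subn1 leq_sub2r //.
by rewrite size_filter count_size.
Qed.

(** * A Liouville-type lower bound over an algebraically closed field *)

Section Liouville.

Variables (C : numClosedFieldType) (q : {poly int}) (ss : seq C) (s : C).
Variables (alpha : nat -> C) (p : nat -> {poly int}) (rs : nat -> seq C).
Variables (d D : nat).
Hypothesis q0 : q != 0.
Hypothesis qE : map_poly intr q = (lead_coef q)%:~R *: \prod_(s <- ss) ('X - s%:P).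
Hypothesis s_ss : s \in ss.
Hypothesis pE : forall n, map_poly intr (p n) = \prod_(r <- rs n) ('X - r%:P).
Hypothesis alpha_rs : forall n, alpha n \in rs n.
Hypothesis rs_le : forall n b, b \in rs n -> `|b| <= `|alpha n|.
Hypothesis alpha0 : forall n, alpha n != 0.
Hypothesis size_rs : forall n, (size (rs n) <= d)%N.
Hypothesis size_ss : (size ss <= D)%N.

(** In division-free form, these are the pairs (A, A (s - sigma)) over all choices of conjugates,
    with repetitions: A is the product of the chosen conjugates of the first N terms and sigma the
    sum of their inverses. *)
Fixpoint conj_pairs (N : nat) : seq (C * C) :=
  if N is N'.+1 then extend_pairs (rs N') (conj_pairs N')
  else [seq (1, s) | s <- ss].

Local Notation P N := (\prod_(n < N) `|alpha n|).

(** If the modulus were below 1, all roots of [p n] would lie in the unit disc, and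
    [nonzero_root_bound] with c = K = 1 would give the opposite. *)
Lemma norm_alpha_ge1 n : 1 <= `|alpha n|.
Proof.
have [//|lt1] := real_leP (real1 _) (normr_real (alpha n)).
have pE1 : map_poly intr (p n) = 1%:~R *: \prod_(b <- rs n) ('X - b%:P) by rewrite scale1r.
have bounded b : b \in rs n -> `|b| <= 1.
  by move/rs_le/le_trans; apply; apply: ltW.
have := nonzero_root_bound pE1 isT (lexx 1) bounded (alpha_rs n) (alpha0 n).
by rewrite expr1n normr1 mul1r mulr1 => /(lt_le_trans lt1); rewrite ltxx.
Qed.

Lemma int_form_conj_pairs N : exists2 c : int,
  c != 0 /\ `|c%:~R : C| <= `|(lead_coef q)%:~R| ^+ (d ^ N) &
  int_form c (conj_pairs N).
Proof.
have lc1 : 1 <= `|(lead_coef q)%:~R : C|.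
  by rewrite -intr_norm -[1]/(1%:~R) ler_int -gtz0_ge1 normr_gt0 lead_coef_eq0.
elim: N => [|N [c [c0 cle] cW]].
  exists (lead_coef q); first by rewrite lead_coef_eq0 q0 expr1.
  exact: int_form_base.
exists (c ^+ size (rs N)); last exact: int_form_extend.
split; first by rewrite expf_neq0.
rewrite rmorphXn normrX.
apply: (@le_trans _ _ ((`|(lead_coef q)%:~R| ^+ (d ^ N)) ^+ size (rs N))).
  by rewrite lerXn2r ?nnegrE ?exprn_ge0.
by rewrite -exprM expnSr ler_weXn2l // leq_mul2l size_rs orbT.
Qed.

Lemma size_conj_pairs N : (size (conj_pairs N) <= D * d ^ N)%N.
Proof.
elim: N => [|N IH]; first by rewrite size_map muln1.
by rewrite size_allpairs expnS mulnCA leq_mul.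
Qed.

Lemma mem_conj_pairs N :
  (\prod_(n < N) alpha n, (\prod_(n < N) alpha n) * (s - \sum_(n < N) (alpha n)^-1))
    \in conj_pairs N.
Proof.
elim: N => [|N IH].
  by rewrite !big_ord0 subr0 mul1r; apply/mapP; exists s.
apply/allpairsP; exists (alpha N, (\prod_(n < N) alpha n,
   (\prod_(n < N) alpha n) * (s - \sum_(n < N) (alpha n)^-1))); split=> //=.
rewrite !big_ord_recr /=; congr (_, _).
by field; apply: alpha0.
Qed.

(** Inverses of conjugates could be large, so none is estimated: in w.2 b - w.1 the subtracted term
    is at most P_N, which is P_(N+1) times the inverse of |alpha_N|. *)
Lemma conj_pairs_le N (B : C) : (forall s', s' \in ss -> `|s'| <= B) ->
  forall w, w \in conj_pairs N ->
  `|w.1| <= P N /\ `|w.2| <= P N * (B + \sum_(n < N) `|alpha n|^-1).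
Proof.
move=> ssB; elim: N => [|N IH] w.
  case/mapP=> s' s'in ->; rewrite !big_ord0 addr0 mul1r normr1; split=> //.
  exact: ssB.
case/allpairsP=> [[b w']] /= [bin w'in ->] /=.
have [IH1 IH2] := IH _ w'in; have bN := rs_le bin.
rewrite !big_ord_recr /=; split.
  by rewrite normrM ler_pM.
apply: (le_trans (ler_normB _ _)); rewrite normrM.
apply: (@le_trans _ _ (P N * (B + \sum_(n < N) `|alpha n|^-1) * `|alpha N| + P N)).
  by rewrite lerD // ler_pM.
rewrite le_eqVlt; apply/orP; left; apply/eqP; field.
by rewrite normr_eq0.
Qed.

(** [A * (s - sN)] is a nonzero root of an integer polynomial with at most D d^N roots, all of
    modulus at most M P_N, so [nonzero_root_bound] applies. *)
Lemma liouville_bound N (B M : C) :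
  1 <= M -> (forall s', s' \in ss -> `|s'| <= B) ->
  B + \sum_(n < N) `|alpha n|^-1 <= M -> s != \sum_(n < N) (alpha n)^-1 ->
  1 <= (`|(lead_coef q)%:~R| * M * P N) ^+ (D * d ^ N)
       * `|s - \sum_(n < N) (alpha n)^-1|.
Proof.
move=> M1 ssB BM sn.
have M0 : 0 <= M := le_trans ler01 M1.
have P1 : 1 <= P N.
  elim: (N) => [|n IH]; first by rewrite big_ord0.
  by rewrite big_ord_recr /= mulr_ege1 ?norm_alpha_ge1.
have P0 : 0 <= P N := le_trans ler01 P1.
have [c [c0 cle] cW] := int_form_conj_pairs N.
have [F FE] := cW _ _ (map_poly intr : {rmorphism {poly int} -> {poly C}})
  (polyC : {rmorphism C -> {poly C}}) 0 (-1) 'X.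
pose bs := [seq w.2 | w <- conj_pairs N].
have {}FE : map_poly intr F = c%:~R *: \prod_(b <- bs) ('X - b%:P) :> {poly C}.
  rewrite [LHS]FE -mul_polyC rmorph_int big_map; congr (_ * _); apply: eq_bigr => w _.
  by rewrite /= map_polyX rmorph0 rmorphN1 mul0r addr0 mulN1r.
pose K := M * P N.
have K1 : 1 <= K by apply: mulr_ege1.
have PK : P N <= K by apply: ler_peMl.
set sN := \sum_(n < N) _ in sn *; set A := \prod_(n < N) alpha n.
have bin : A * (s - sN) \in bs.
  by apply/mapP; exists (A, A * (s - sN)) => //; apply: mem_conj_pairs.
have b0 : A * (s - sN) != 0.
  rewrite mulf_neq0 ?subr_eq0 // prodf_seq_neq0; apply/allP => n _ /=.
  exact: alpha0.
have bK b : b \in bs -> `|b| <= K.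
  case/mapP=> w win ->; have [_ /le_trans] := conj_pairs_le ssB win; apply.
  by rewrite mulrC ler_wpM2r.
have := nonzero_root_bound FE c0 K1 bK bin b0; move/le_trans; apply.
have bs_gt0 : (0 < size bs)%N by case: (bs) bin.
have Dd0 : (0 < D * d ^ N)%N.
  by apply: leq_trans (size_conj_pairs N); rewrite -(size_map snd).
have D0 : (0 < D)%N by move: Dd0; rewrite muln_gt0 => /andP[].
have lc1 : 1 <= `|(lead_coef q)%:~R : C|.
  by rewrite -intr_norm -[1]/(1%:~R) ler_int -gtz0_ge1 normr_gt0 lead_coef_eq0.
rewrite -(mulrA _ M) -/K; clearbody K; rewrite exprMn normrM -!mulrA.
apply: ler_pM; rewrite ?mulr_ge0 ?exprn_ge0 ?(le_trans ler01 K1) //.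
  by apply: (le_trans cle); rewrite ler_weXn2l // leq_pmull.
rewrite normr_prod mulrCA [leRHS]mulrC; apply: ler_wpM2l => //.
(* The modulus P_N <= K of [A] supplies the factor missing in the exponent [(size bs).-1]. *)
apply: (@le_trans _ _ (K ^+ size bs)).
  rewrite -[in leRHS](prednK bs_gt0) exprS ler_wpM2r ?exprn_ge0 ?(le_trans ler01 K1) //.
by rewrite ler_weXn2l // size_map size_conj_pairs.
Qed.

End Liouville.

(** * Complex numbers as pairs of reals *)

Local Notation C := (complex R).
Local Notation toC := (fun z : Cx => Complex z.1 z.2 : C).

Lemma toC_sub z w : toC (Csub z w) = toC z - toC w.
Proof. by []. Qed.

Lemma toC_inv z : toC (Cinv z) = (toC z)^-1.
Proof.
by case: z => a b; congr Complex; rewrite /= RdivE RplusE !RmultE ?RoppE -!expr2 ?mulNr.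
Qed.

Lemma toC_norm z : `|toC z| = (Cnorm z)%:C%C.
Proof. by rewrite normc_def /Cnorm RsqrtE RplusE !RmultE !expr2. Qed.

Lemma toC_inj : injective toC.
Proof. by case=> [a b] [a' b'] [-> ->]. Qed.

Lemma toC_Z c : toC (ZtoC c) = (int_of_Z c)%:~R.
Proof.
have natE n : toC (INR n, 0) = n%:R by rewrite INRE -(rmorph_nat (real_complex R)).
case: c => [|p|p] //=.
  by rewrite -[IZR (Z.pos p)]/(IPR p) -INR_IPR; apply: natE.
rewrite NegzE mulrNz prednK; last by apply/ssrnat.ltP/Pos2Nat.is_pos.
by rewrite -pmulrn -natE /= INR_IPR -[RHS]/(Complex (- IPR p) (- 0)) oppr0.
Qed.

(** * Integer polynomials, minimal polynomials and conjugates *)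

Definition int_poly (l : list Z) : {poly int} := Poly (map int_of_Z l).

Lemma toC_peval l z : toC (peval l z) = (map_poly intr (int_poly l)).[toC z].
Proof.
elim: l => [|c l IH]; first by rewrite /= rmorph0 horner0.
rewrite /int_poly /= cons_poly_def rmorphD rmorphM /= map_polyX map_polyC hornerMXaddC -IH.
by rewrite -[X in _ + X]/((int_of_Z c)%:~R) -toC_Z addrC mulrC.
Qed.

Lemma proot_int_poly l z : proot l z <-> root (map_poly intr (int_poly l)) (toC z).
Proof.
rewrite /proot /root -toC_peval; split=> [->|/eqP] //.
exact: (@toC_inj _ (0, 0)).
Qed.

Lemma int_poly_eq0 l : pnonzero l <-> int_poly l != 0.
Proof.
split=> [l0|].
  apply: contraTneq isT => /polyP lE; exfalso; move: l0 lE.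
  elim: l => [|c l IH]; first by move/Exists_nil.
  case/Exists_cons => [c0 /(_ 0%N)|l0 lE].
    rewrite coef_Poly coef0 /= => /(congr1 Z_of_int); rewrite int_of_ZK; exact: c0.
  by apply: (IH l0) => i; have := lE i.+1; rewrite !coef_Poly !coef0.
elim: l => [|c l IH]; first by rewrite eqxx.
move=> lE; apply/Exists_cons; case: (Z.eq_dec c 0) => [c0|]; [right|by left].
apply: IH; apply: contraNneq lE => lE.
by rewrite /int_poly /= c0 cons_poly_def -/(int_poly l) lE mul0r addr0.
Qed.

Lemma length_size (T : Type) (l : list T) : length l = size l.
Proof. by elim: l => //= x l ->. Qed.

Lemma int_poly_surj (q : {poly int}) :
  exists l, int_poly l = q /\ length l = size q.
Proof.
exists (map Z_of_int q); rewrite length_size size_map; split=> //.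
by rewrite /int_poly -map_comp map_id_in ?polyseqK // => x _; apply: Z_of_intK.
Qed.

(** [Poly] drops trailing zeros, so the list of length k + 1 could give a smaller size; minimality
    of k rules this out. *)
Lemma alg_deg_poly z k : alg_deg z k -> exists q : {poly int},
  [/\ size q = k.+1, root (map_poly intr q) (toC z) &
   forall q' : {poly int}, q' != 0 -> (size q' <= k)%N -> ~ root (map_poly intr q') (toC z)].
Proof.
case=> [[l [l0 [ll lz]]] lmin].
have qmin (q : {poly int}) : q != 0 -> (size q <= k)%N -> ~ root (map_poly intr q) (toC z).
  have [l' [<- l'E]] := int_poly_surj q => /int_poly_eq0 l'0 sz /proot_int_poly.
  by apply: lmin => //; apply/ssrnat.leP; rewrite l'E.
exists (int_poly l); split=> //; last exact/proot_int_poly.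
apply/eqP; rewrite eqn_leq (leq_trans (size_Poly _)) ?size_map -?length_size ?ll //=.
rewrite ltnNge; apply/negP => /qmin; apply; first exact/int_poly_eq0.
exact/proot_int_poly.
Qed.

Lemma conjugate_root z k (q : {poly int}) w : alg_deg z k -> size q = k.+1 ->
  root (map_poly intr q) (toC z) -> root (map_poly intr q) (toC w) -> conjugate z w.
Proof.
move=> zk qk; have [l [lq lE]] := int_poly_surj q.
rewrite -lq => /proot_int_poly lz /proot_int_poly lw; exists k, l; split=> //.
split; last by rewrite lE.
by apply/int_poly_eq0; rewrite lq -size_poly_gt0 qk.
Qed.

(* Gauss's lemma: the primitive part of a minimal integer polynomial of z divides
   a monic integer polynomial. *)
Lemma alg_integer_min_poly z k : alg_integer z -> alg_deg z k ->
  exists2 p : {poly int}, p \is monic &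
    [/\ size p = k.+1, root (map_poly intr p) (toC z) &
     forall w, root (map_poly intr p) (toC w) -> conjugate z w].
Proof.
move=> [l [llast lz]] zk; have [q [qk qz qmin]] := alg_deg_poly zk.
have q0 : q != 0 by rewrite -size_poly_gt0 qk.
pose P := int_poly l.
have Pz : root (map_poly intr P) (toC z) by apply/proot_int_poly.
have Pm : P \is monic.
  have lastE : last (int_of_Z Z0) (map int_of_Z l) = 1.
    rewrite last_map -[1]/(int_of_Z 1) -llast; congr int_of_Z.
    by case: (l) => //= a l'; elim: l' a => //= b l' IH a.
  rewrite monicE /lead_coef /P /int_poly (@PolyK _ (int_of_Z Z0)) ?lastE //.
  by rewrite nth_last lastE.
(* The remainder of [P] modulo [q] vanishes at z and has size at most k, so it is 0 by
   minimality. *)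
have qP : q %| P.
  apply/Pdiv.Idomain.modp_eq0P/eqP; apply: contraT => r0; exfalso; apply: (qmin _ r0).
    by rewrite -ltnS -qk Pdiv.Idomain.ltn_modp.
  have := congr1 (fun r : {poly int} => (map_poly intr r).[toC z])
    (Pdiv.Idomain.divp_eq P q).
  rewrite map_polyZ rmorphD rmorphM /= hornerZ hornerD hornerM.
  by rewrite (rootP Pz) (rootP qz) !mulr0 add0r => /esym/rootP.
have [r Pr] := dvdpP_int qP.
have qprim : map_poly intr q = (zcontents q)%:~R *: map_poly intr (zprimitive q) :> {poly C}.
  by rewrite -map_polyZ -zpolyEprim.
have zc0 : (zcontents q)%:~R != 0 :> C by rewrite intr_eq0 zcontents_eq0.
exists (zprimitive q).
  (* The leading coefficient divides 1, and a primitive part of a nonzero polynomial has a positive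
     one, so it is 1. *)
  have := sgz_lead_primitive q; rewrite q0.
  have := congr1 lead_coef Pr; rewrite lead_coefM (monicP Pm) monicE.
  move=> /esym/(congr1 absz)/eqP; rewrite abszM muln_eq1.
  by case: (lead_coef (zprimitive q)) => [[|[|n]]|[|n]].
have rootE w : root (map_poly intr (zprimitive q)) (toC w) =
               root (map_poly intr q) (toC w).
  by rewrite qprim rootZ.
split; first by rewrite size_zprimitive.
  by rewrite rootE.
by move=> w; rewrite rootE; apply: conjugate_root zk qk qz.
Qed.

Lemma int_poly_roots (q : {poly int}) : exists rs : seq C,
  [/\ map_poly intr q = (lead_coef q)%:~R *: \prod_(r <- rs) ('X - r%:P),
      size rs = (size q).-1 &
      q != 0 -> forall w, (w \in rs) = root (map_poly intr q) w].
Proof.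
have [rs rsE] := closed_field_poly_normal (map_poly intr q : {poly C}).
have lE : lead_coef (map_poly intr q : {poly C}) = (lead_coef q)%:~R.
  by rewrite lead_coef_map_inj //; apply: intr_inj.
rewrite lE in rsE.
have [->|q0] := eqVneq q 0.
  by exists [::]; rewrite rmorph0 lead_coef0 scale0r size_poly0; split=> //; rewrite eqxx.
have lc0 : (lead_coef q)%:~R != 0 :> C by rewrite intr_eq0 lead_coef_eq0.
exists rs; split=> // [|_ w].
  have := congr1 (fun p : {poly C} => size p) rsE.
  rewrite size_map_inj_poly ?size_scale ?size_prod_XsubC //; first by move=> ->.
  exact: intr_inj.
by rewrite rsE rootZ // root_prod_XsubC.
Qed.

Lemma toC_sum_lt (f : nat -> Cx) N : toC (Csum_lt f N) = \sum_(n < N) toC (f n).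
Proof. by elim: N => [|N IH]; rewrite ?big_ord0 // big_ord_recr -IH. Qed.

Lemma sum_ltE (f : nat -> R) N : sum_lt f N = \sum_(n < N) f n.
Proof. by elim: N => [|N IH]; rewrite ?big_ord0 // big_ord_recr -IH. Qed.

Lemma prod_ltE (f : nat -> R) N : prod_lt f N = \prod_(n < N) f n.
Proof. by elim: N => [|N IH]; rewrite ?big_ord0 // big_ord_recr -IH. Qed.

Lemma toC_surj (w : C) : exists z, w = toC z.
Proof. by case: w => a b; exists (a, b). Qed.

(** Polynomial and root list form one pair so that a single choice over n selects both. The house
    bounds all the roots because each is a conjugate of z. *)
Lemma alg_integer_conjugates (d : nat) z : alg_integer z ->
  (exists k, (k <= d)%coq_nat /\ alg_deg z k) -> house z (Cnorm z) ->
  exists prs : {poly int} * seq C,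
  [/\ map_poly intr prs.1 = \prod_(r <- prs.2) ('X - r%:P), toC z \in prs.2,
      (size prs.2 <= d)%N & forall b, b \in prs.2 -> `|b| <= `|toC z|].
Proof.
move=> zint [k [kd zk]] [_ zhouse].
have [p pm [pk pz pconj]] := alg_integer_min_poly zint zk.
have [rs [rsE rss rsroot]] := int_poly_roots p.
have p0 : p != 0 by rewrite monic_neq0.
exists (p, rs); split=> /=.
- by rewrite rsE (monicP pm) scale1r.
- by rewrite rsroot.
- by rewrite rss pk; apply/ssrnat.leP.
move=> b; rewrite rsroot //; have [w ->] := toC_surj b => /pconj/zhouse wz.
by rewrite !toC_norm lecR; apply/RleP.
Qed.

Local Close Scope ring_scope.
Local Open Scope R_scope.

(** [M] stays free: once the series of inverses converges, one value of it serves every N. *)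
Theorem liouville (d D k : nat) (alpha : nat -> Cx) (s : Cx) :
  (forall n, alg_integer (alpha n)) ->
  (forall n, exists k, (k <= d)%coq_nat /\ alg_deg (alpha n) k) ->
  (forall n, house (alpha n) (Cnorm (alpha n))) ->
  (forall n, alpha n <> (0, 0)) ->
  (k <= D)%coq_nat -> alg_deg s k ->
  (forall n, 1 <= Cnorm (alpha n)) /\
  exists c B : R, 1 <= c /\ forall N M, 1 <= M ->
    B + sum_lt (fun n => / Cnorm (alpha n)) N <= M ->
    s <> Csum_lt (fun n => Cinv (alpha n)) N ->
    1 <= pow (c * M * prod_lt (fun n => Cnorm (alpha n)) N) (Nat.mul D (Nat.pow d N))
         * Cnorm (Csub s (Csum_lt (fun n => Cinv (alpha n)) N)).
Proof.
move=> aint adeg ahouse a0 kD sk.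
have [prs prsP] := functional_choice _
  (fun n => alg_integer_conjugates (aint n) (adeg n) (ahouse n)).
have [q [qk qs qmin]] := alg_deg_poly sk.
have q0 : q != 0%R by rewrite -size_poly_gt0 qk.
have [ss [ssE sss ssroot]] := int_poly_roots q.
have s_ss : toC s \in ss by rewrite ssroot.
have ss_le : (size ss <= D)%N by rewrite sss qk; apply/ssrnat.leP.
have a0' n : toC (alpha n) != 0%R.
  by apply/eqP => /(@toC_inj _ (0, 0)); apply: a0.
pose p n := (prs n).1; pose rs n := (prs n).2.
have pE n : map_poly intr (p n) = (\prod_(r <- rs n) ('X - r%:P))%R by case: (prsP n).
have ars n : toC (alpha n) \in rs n by case: (prsP n).
have rs_le n b : b \in rs n -> (`|b| <= `|toC (alpha n)|)%R.
  by case: (prsP n) => _ _ _; apply.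
have rs_size n : (size (rs n) <= d)%N by case: (prsP n).
split=> [n|].
  have := norm_alpha_ge1 pE ars rs_le a0' n.
  by rewrite toC_norm -(rmorph1 (real_complex R)) lecR => /RleP.
(* [B] is the sum of the moduli of the conjugates of s, which bounds each of them. *)
exists (`|lead_coef q|%:~R)%R, (\sum_(r <- ss) Normc.normc r)%R; split.
  apply/RleP; suff: ((1%:~R : R) <= `|lead_coef q|%:~R)%R by [].
  by rewrite ler_int -gtz0_ge1 normr_gt0 lead_coef_eq0.
move=> N M M1 BM sN.
pose B : C := (\sum_(r <- ss) `|r|)%R.
have := @liouville_bound C q ss (toC s) (fun n => toC (alpha n)) p rs d D q0 ssE s_ss
  pE ars rs_le a0' rs_size ss_le N B (M%:C)%C.
have sumE : (\sum_(n < N) (toC (alpha n))^-1)%R = toC (Csum_lt (fun n => Cinv (alpha n)) N).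
  by rewrite toC_sum_lt; apply: eq_bigr => n _; rewrite toC_inv.
have isumE : (\sum_(n < N) `|toC (alpha n)|^-1)%R =
    ((sum_lt (fun n => / Cnorm (alpha n)) N)%:C)%C.
  by rewrite sum_ltE rmorph_sum; apply: eq_bigr => n _; rewrite toC_norm fmorphV.
have prodE : (\prod_(n < N) `|toC (alpha n)|)%R =
    ((prod_lt (fun n => Cnorm (alpha n)) N)%:C)%C.
  by rewrite prod_ltE rmorph_prod; apply: eq_bigr => n _; rewrite toC_norm.
have lcE : (`|(lead_coef q)%:~R : C|)%R = ((`|lead_coef q|%:~R)%R%:C)%C.
  by rewrite -intr_norm rmorph_int.
have BE : B = ((\sum_(r <- ss) Normc.normc r)%R%:C)%C by rewrite rmorph_sum.
rewrite sumE isumE prodE lcE BE -toC_sub toC_norm.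
have powE : (D * d ^ N)%N = Nat.mul D (Nat.pow d N).
  by congr muln; elim: N {BM sN sumE isumE prodE} => //= N <-; rewrite expnS.
rewrite -powE RpowE -(rmorph1 (real_complex R)) -!rmorphM -rmorphXn -rmorphM -rmorphD.
rewrite !lecR => H; apply/RleP; apply: H.
- exact/RleP.
- move=> s' s'in; rewrite -BE /B (big_rem s') //= lerDl.
  by apply: sumr_ge0.
- exact/RleP.
by apply/eqP => /toC_inj.
Qed.
End Liouville.

(** * Growth of the sequence *)

Lemma pow2_pos n : 0 < 2 ^ n.
Proof. apply pow_lt; lra. Qed.

Lemma pow2_le_exp n : 2 ^ n <= exp (INR n).
Proof.
induction n as [|n IH]; [simpl; rewrite exp_0; lra|].
rewrite S_INR, exp_plus. simpl.
generalize (exp_ineq1 1 ltac:(lra)) (pow2_pos n). intros. nra.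
Qed.

Lemma pow2_bracket x : 1 <= x -> exists X, 2 ^ X <= x < 2 ^ S X.
Proof.
intros Hx.
assert (H : forall Y, x < 2 ^ Y -> exists X, 2 ^ X <= x < 2 ^ S X).
{ induction Y as [|Y IH]; [simpl; lra|]. intros H.
  destruct (Rlt_or_le x (2 ^ Y)) as [H1|H1]; [auto|]. exists Y. split; assumption. }
destruct (Pow_x_infinity 2 ltac:(rewrite Rabs_pos_eq; lra) (x + 1)) as [Y HY].
apply (H Y). specialize (HY Y (le_n Y)).
rewrite Rabs_pos_eq in HY; [lra | left; apply pow2_pos].
Qed.

Lemma cube_le_pow2 n : INR n ^ 3 <= 27 * 2 ^ n.
Proof.
destruct (Nat.le_gt_cases n 3) as [Hn|Hn].
- assert (H : (n = 0 \/ n = 1 \/ n = 2 \/ n = 3)%nat) by lia.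
  destruct H as [->|[->|[->| ->]]]; simpl; lra.
- induction Hn as [|n Hn IH]; [simpl; lra|].
  assert (4 <= INR n) by (apply (le_INR 4) in Hn; simpl in Hn; lra).
  rewrite S_INR. simpl (2 ^ S n). assert (0 <= INR n * INR n * (INR n - 4)) by nra.
  simpl in *. nra.
Qed.

Lemma last_before (P : nat -> Prop) n k : (n < k)%nat -> P n ->
  exists m, (n <= m < k)%nat /\ P m /\ forall j, (m < j < k)%nat -> ~ P j.
Proof.
intros Hnk Hn. induction Hnk as [|k Hnk IH].
- exists n. repeat split; auto; intros; lia.
- destruct (classic (P k)) as [Hk|Hk].
  + exists k. repeat split; auto; lia.
  + destruct IH as [m [Hm [Pm Hj]]]. exists m. repeat split; auto; try lia.
    intros j Hj'. destruct (Nat.eq_dec j k) as [->|]; [assumption | apply Hj; lia].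
Qed.

Lemma first_from (P : nat -> Prop) n k : (n <= k)%nat -> P k ->
  exists m, (n <= m <= k)%nat /\ P m /\ forall j, (n <= j < m)%nat -> ~ P j.
Proof.
induction k as [k IH] using lt_wf_ind. intros Hnk Hk.
destruct (classic (exists j, (n <= j < k)%nat /\ P j)) as [[j [Hj Pj]]|C].
- destruct (IH j ltac:(lia) ltac:(lia) Pj) as [m [Hm H]].
  exists m. split; [lia | exact H].
- exists k. repeat split; auto. intros j Hj Pj. apply C. exists j. auto.
Qed.

(** This compares t^(-1-eps) with its integral over an interval of length 1; exp t >= 1 + t, used
    twice, replaces the mean value theorem. *)
Lemma Rpower_telescope eps x : 0 < eps -> 1 <= x ->
  eps * Rpower (x + 1) (- (1 + eps)) <= Rpower x (- eps) - Rpower (x + 1) (- eps).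
Proof.
intros He Hx.
assert (E1 : Rpower (x + 1) (- (1 + eps)) = Rpower (x + 1) (- eps) * / (x + 1)).
{ replace (- (1 + eps)) with (- eps + Ropp 1) by ring.
  rewrite Rpower_plus, Rpower_Ropp, Rpower_Ropp, Rpower_1; [reflexivity | lra]. }
assert (E2 : Rpower x (- eps) = Rpower (x + 1) (- eps) * exp (eps * (ln (x + 1) - ln x))).
{ unfold Rpower. rewrite <- exp_plus. f_equal. ring. }
assert (E3 : / (x + 1) <= ln (x + 1) - ln x).
{ assert (H := exp_ineq1_le (ln x - ln (x + 1))).
  unfold Rminus in H. rewrite exp_plus, exp_Ropp, !exp_ln in H by lra.
  replace (x * / (x + 1)) with (1 - / (x + 1)) in H by (field; lra). lra. }
assert (E4 := exp_ineq1_le (eps * (ln (x + 1) - ln x))).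
assert (E5 : 0 < Rpower (x + 1) (- eps)) by apply exp_pos.
rewrite E1, E2.
assert (eps * / (x + 1) <= eps * (ln (x + 1) - ln x)) by (apply Rmult_le_compat_l; lra).
nra.
Qed.

Lemma inv_le_telescope eps n y : 0 < eps -> (1 <= n)%nat ->
  Rpower (INR (S n)) (1 + eps) <= y ->
  / y <= / eps * (Rpower (INR n) (- eps) - Rpower (INR (S n)) (- eps)).
Proof.
intros He Hn Hy.
assert (P := Rpower_telescope eps (INR n) He ltac:(apply (le_INR 1); lia)).
rewrite <- S_INR, Rpower_Ropp in P.
apply Rle_trans with (/ Rpower (INR (S n)) (1 + eps)).
- apply Rinv_le_contravar; [apply exp_pos | exact Hy].
- apply Rmult_le_reg_l with eps; [lra|]. rewrite <- Rmult_assoc, Rinv_r; lra.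
Qed.

(** * The contradiction for real sequences *)

Section Analysis.

(* b n = |alpha_(n+1)|, T n is the sum of / b m over m >= n, u n = log (C P_n),
   q n = D d^n and F n = E_n. *)
Variables (eps : R) (b T u q F : nat -> R) (N0 : nat).
Hypothesis eps_pos : 0 < eps.
Hypothesis b_ge1 : forall n, 1 <= b n.
Hypothesis b_mono : forall n m, (n <= m)%nat -> b n <= b m.
Hypothesis b_growth : forall n, (N0 <= n)%nat -> Rpower (INR (S n)) (1 + eps) <= b n.
Hypothesis T_rec : forall n, T n = / b n + T (S n).
Hypothesis T_lim : forall eta, 0 < eta -> exists N, forall n, (N <= n)%nat -> T n < eta.
Hypothesis u_ge0 : forall n, 0 <= u n.
Hypothesis u_rec : forall n, u (S n) = u n + ln (b n).
Hypothesis q_ge0 : forall n, 0 <= q n.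
Hypothesis F_ge : forall n, (1 <= n)%nat -> 2 ^ (n - 1) <= F n.
Hypothesis F_rec : forall n, (1 <= n)%nat -> (1 + q n) * F n <= F (S n).
Hypothesis T_lower : forall n, 1 <= exp (q n * u n) * T n.
Hypothesis b_limsup : forall K N, exists n, (N <= n)%nat /\ K * F (S n) < ln (b n).

Lemma ln_b_ge0 n : 0 <= ln (b n).
Proof.
rewrite <- ln_1.
destruct (b_ge1 n) as [H | H].
- left; apply ln_increasing; lra.
- rewrite <- H; lra.
Qed.

(** What is kept of a good step: the bound of [T_block_le] accounts for at least half of what
    [T_lower] demands. The other half is left for the tail beyond a block. *)
Definition small_step m :=
  1 <= 2 * exp (q m * u m) * (2 * ln (b m) + 4) / b m.

(* Chosen so that excess m - excess (m + 1) = (m + 4) / 2^m absorbs the additive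
   error of [ln_b_le]. *)
Definition excess m := 2 * (INR m + 5) / 2 ^ m.

(** The last factor drops by exp (1/2^m) at step m, which pays for the relative error 1 + 1/2^m in
    [ln_b_le]. *)
Definition potential m := (u m / F m + excess m) * exp (2 / 2 ^ m).

Lemma F_pos n : (1 <= n)%nat -> 0 < F n.
Proof. intros Hn. generalize (F_ge n Hn) (pow2_pos (n - 1)). lra. Qed.

(** With l = ln (b m), a small step bounds exp l by a multiple of exp (q m u m) (1 + l). The
    inequality exp t >= 1 + t trades 1 + l for exp (th (1 + l) - 1) and a power of 2; the small term
    th l then moves to the left. *)
Lemma ln_b_le m : small_step m ->
  ln (b m) <= (1 + / 2 ^ m) * (q m * u m + INR m + 4).
Proof.
intros H. unfold small_step in H.
set (l := ln (b m)) in *. assert (Hl : 0 <= l) by apply ln_b_ge0.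
assert (Hb : b m = exp l) by (unfold l; rewrite exp_ln; generalize (b_ge1 m); lra).
rewrite Hb in H.
set (th := / (2 * 2 ^ m)).
assert (Hp : 1 <= 2 ^ m) by (apply pow_R1_Rle; lra).
assert (Hth : 0 < th <= / 2).
{ unfold th; split; [apply Rinv_0_lt_compat; lra|].
  apply Rinv_le_contravar; lra. }
assert (Hth2 : / 2 ^ m = 2 * th) by (unfold th; field; lra).
assert (E1 : th * (1 + l) <= exp (th * (1 + l) - 1)).
{ generalize (exp_ineq1_le (th * (1 + l) - 1)). lra. }
assert (E2 : exp l <= 8 * exp (q m * u m) * (1 + l)).
{ assert (He := exp_pos l). assert (Hq := exp_pos (q m * u m)).
  apply (Rmult_le_compat_r (exp l)) in H; [|lra].
  replace (2 * exp (q m * u m) * (2 * l + 4) / exp l * exp l)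
    with (2 * exp (q m * u m) * (2 * l + 4)) in H by (field; lra).
  nra. }
assert (E3 : 1 + l <= 2 * 2 ^ m * exp (th * (1 + l) - 1)).
{ replace (1 + l) with (2 * 2 ^ m * (th * (1 + l))) at 1 by (unfold th; field; lra).
  apply Rmult_le_compat_l; lra. }
assert (E4 : exp l <= exp (q m * u m + (INR (m + 4) + (th * (1 + l) - 1)))).
{ rewrite exp_plus, exp_plus.
  generalize (pow2_le_exp (m + 4)). rewrite pow_add. intros E5.
  eapply Rle_trans; [exact E2|].
  assert (Hq := exp_pos (q m * u m)). assert (He := exp_pos (th * (1 + l) - 1)).
  rewrite (Rmult_comm 8), Rmult_assoc. apply Rmult_le_compat_l; [lra|].
  eapply Rle_trans; [apply Rmult_le_compat_l; [lra | exact E3]|].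
  replace (8 * (2 * 2 ^ m * exp (th * (1 + l) - 1)))
    with ((2 ^ m * 2 ^ 4) * exp (th * (1 + l) - 1)) by (simpl; ring).
  apply Rmult_le_compat_r; lra. }
assert (E5 : l <= q m * u m + (INR (m + 4) + (th * (1 + l) - 1))).
{ destruct (Rle_or_lt l (q m * u m + (INR (m + 4) + (th * (1 + l) - 1)))) as [|C]; [assumption|].
  apply exp_increasing in C. lra. }
rewrite plus_INR in E5. simpl (INR 4) in E5. rewrite Hth2.
assert (Hqu : 0 <= q m * u m) by (apply Rmult_le_pos; auto).
assert (Hm := pos_INR m).
assert (E6 : (1 - th) * l <= q m * u m + INR m + 4) by lra.
(* (1 + 2 th)(1 - th) = 1 + th (1 - 2 th) >= 1, which is why [th] is half of 1/2^m. *)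
assert (E7 : 0 <= th * (1 - 2 * th) * l) by (apply Rmult_le_pos; [apply Rmult_le_pos|]; lra).
apply Rle_trans with ((1 + 2 * th) * ((1 - th) * l)); [lra|].
apply Rmult_le_compat_l; lra.
Qed.

(** The bound (1 + q m) F m for [F (S m)] absorbs the main term, and the bound 2^m absorbs the
    additive m + 4. With h = 1/2^m, the error (m + 4) h plus the new excess (m + 6) h is exactly the
    old excess. *)
Lemma potential_step m : (1 <= m)%nat -> small_step m ->
  potential (S m) <= potential m.
Proof.
intros Hm H. apply ln_b_le in H. unfold potential, excess.
assert (Hp : 1 <= 2 ^ m) by (apply pow_R1_Rle; lra).
set (h := / 2 ^ m) in *.
assert (Hh : 0 < h) by (apply Rinv_0_lt_compat; lra).
rewrite S_INR. simpl (2 ^ S m).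
replace (2 * (INR m + 1 + 5) / (2 * 2 ^ m)) with ((INR m + 6) * h) by (unfold h; field; lra).
replace (2 * (INR m + 5) / 2 ^ m) with ((2 * INR m + 10) * h) by (unfold h; field; lra).
replace (2 / (2 * 2 ^ m)) with h by (unfold h; field; lra).
replace (2 / 2 ^ m) with (h + h) by (unfold h; field; lra).
rewrite exp_plus, <- Rmult_assoc.
apply Rmult_le_compat_r; [left; apply exp_pos|].
assert (HF := F_pos m Hm). assert (HF' := F_pos (S m) ltac:(lia)).
assert (HFr := F_rec m Hm).
assert (HFge := F_ge (S m) ltac:(lia)). replace (S m - 1)%nat with m in HFge by lia.
assert (Hu := u_ge0 m). assert (Hq := q_ge0 m). assert (HI := pos_INR m).
assert (V0 : 0 <= u m / F m) by (apply Rmult_le_pos; [lra | left; apply Rinv_0_lt_compat; lra]).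
assert (V1 : u (S m) / F (S m) <= (1 + h) * (u m / F m + (INR m + 4) * h)).
{ apply Rle_trans with ((1 + h) * ((1 + q m) * u m + INR m + 4) / F (S m)).
  - apply Rmult_le_compat_r; [left; apply Rinv_0_lt_compat; lra|].
    rewrite u_rec. nra.
  - unfold Rdiv at 1. rewrite Rmult_assoc. apply Rmult_le_compat_l; [lra|].
    replace ((1 + q m) * u m + INR m + 4) with ((1 + q m) * F m * (u m / F m) + (INR m + 4))
      by (field; lra).
    rewrite Rmult_plus_distr_r. apply Rplus_le_compat.
    + apply Rle_trans with (F (S m) * (u m / F m) * / F (S m)).
      * apply Rmult_le_compat_r; [left; apply Rinv_0_lt_compat; lra|].
        apply Rmult_le_compat_r; lra.
      * right; field; lra.
    + apply Rmult_le_compat_l; [lra|]. apply Rinv_le_contravar; lra. }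
assert (He := exp_ineq1_le h).
apply Rle_trans with ((1 + h) * (u m / F m + (2 * INR m + 10) * h)).
- assert (0 <= h * ((INR m + 6) * h)) by nra. nra.
- rewrite Rmult_comm. apply Rmult_le_compat_l; [|lra]. nra.
Qed.

Lemma potential_mono t n : (1 <= t <= n)%nat ->
  (forall m, (t <= m < n)%nat -> small_step m) -> potential n <= potential t.
Proof.
intros [Ht Hn]. induction Hn as [|n Hn IH]; intros H; [lra|].
eapply Rle_trans; [apply potential_step; [lia | apply H; lia]|].
apply IH. intros m Hm. apply H. lia.
Qed.

Lemma ratio_le_potential n : (1 <= n)%nat -> u n / F n <= potential n.
Proof.
intros Hn. unfold potential, excess.
assert (HF := F_pos n Hn). assert (Hu := u_ge0 n). assert (HI := pos_INR n).
assert (V0 : 0 <= u n / F n) by (apply Rmult_le_pos; [lra | left; apply Rinv_0_lt_compat; lra]).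
assert (0 <= 2 * (INR n + 5) / 2 ^ n).
{ apply Rmult_le_pos; [lra|]. left; apply Rinv_0_lt_compat, pow2_pos. }
assert (0 <= 2 / 2 ^ n).
{ apply Rmult_le_pos; [lra|]. left; apply Rinv_0_lt_compat, pow2_pos. }
assert (He := exp_ineq1_le (2 / 2 ^ n)). nra.
Qed.

Lemma potential_le t : (1 <= t)%nat -> potential t <= 3 * (u t / F t + excess t).
Proof.
intros Ht. unfold potential. rewrite Rmult_comm.
apply Rmult_le_compat_r.
- assert (HF := F_pos t Ht). assert (Hu := u_ge0 t). assert (HI := pos_INR t).
  unfold excess. apply Rplus_le_le_0_compat; apply Rmult_le_pos; try lra;
    left; apply Rinv_0_lt_compat; [lra | apply pow2_pos].
- apply Rle_trans with (exp 1); [|apply exp_le_3].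
  destruct t as [|t]; [lia|]. simpl.
  assert (1 <= 2 ^ t) by (apply pow_R1_Rle; lra).
  assert (2 / (2 * 2 ^ t) <= 1).
  { apply Rmult_le_reg_r with (2 * 2 ^ t); [lra|]. field_simplify; lra. }
  destruct (Req_dec (2 / (2 * 2 ^ t)) 1) as [-> | Hne]; [lra|].
  left. apply exp_increasing. lra.
Qed.

Lemma T_diff_le n j c : (forall m, (n <= m < n + j)%nat -> / b m <= c) ->
  T n - T (n + j) <= INR j * c.
Proof.
induction j as [|j IH]; intros H.
- rewrite Nat.add_0_r. simpl. lra.
- rewrite S_INR. replace (n + S j)%nat with (S (n + j)) by lia.
  assert (E := T_rec (n + j)). assert (H1 := H (n + j)%nat ltac:(lia)).
  assert (IH' : T n - T (n + j) <= INR j * c) by (apply IH; intros; apply H; lia).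
  lra.
Qed.

Lemma T_diff_geom n j : (forall m, (n <= m < n + j)%nat -> 2 ^ m < b m) ->
  T n - T (n + j) <= 2 / 2 ^ n - 2 / 2 ^ (n + j).
Proof.
induction j as [|j IH]; intros H.
- rewrite Nat.add_0_r. lra.
- replace (n + S j)%nat with (S (n + j)) by lia.
  assert (E := T_rec (n + j)). assert (H1 := H (n + j)%nat ltac:(lia)).
  assert (IH' : T n - T (n + j) <= 2 / 2 ^ n - 2 / 2 ^ (n + j))
    by (apply IH; intros; apply H; lia).
  assert (Hp := pow2_pos (n + j)).
  assert (/ b (n + j)%nat <= / 2 ^ (n + j)) by (apply Rinv_le_contravar; lra).
  replace (2 / 2 ^ S (n + j)) with (2 / 2 ^ (n + j) - / 2 ^ (n + j)) by (simpl; field; lra).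
  lra.
Qed.

(** Cut at X with 2^X <= b n < 2^(X+1). Before X there are at most X <= 2 ln (b n) terms, each at
    most 1 / b n by monotonicity; after X the geometric tail is at most 2/2^X <= 4 / b n. *)
Lemma T_block_le n k : (n <= k)%nat -> (forall m, (n <= m < k)%nat -> 2 ^ m < b m) ->
  T n - T k <= (2 * ln (b n) + 4) / b n.
Proof.
intros Hnk H. assert (Hb1 := b_ge1 n). assert (Hl := ln_b_ge0 n).
assert (Hib : 0 < / b n) by (apply Rinv_0_lt_compat; lra).
destruct (Nat.eq_dec n k) as [->|Hne].
{ unfold Rdiv. nra. }
destruct (pow2_bracket (b n) Hb1) as [X [HX1 HX2]].
assert (HnX : (n <= X)%nat).
{ assert (Hn := H n ltac:(lia)). destruct (Nat.le_gt_cases n X) as [|C]; [assumption|].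
  assert (2 ^ S X <= 2 ^ n) by (apply Rle_pow; [lra|lia]). lra. }
assert (HXl : INR X <= 2 * ln (b n)).
{ assert (E : ln (2 ^ X) <= ln (b n)).
  { destruct HX1 as [HX1|HX1]; [left; apply ln_increasing; [apply pow2_pos|assumption]|].
    rewrite HX1; lra. }
  rewrite ln_pow in E by lra. assert (L := ln_lt_2). assert (HI := pos_INR X). nra. }
assert (Hmono : forall m, (n <= m)%nat -> / b m <= / b n).
{ intros m Hm. apply Rinv_le_contravar; [lra | apply b_mono; lia]. }
unfold Rdiv. rewrite Rmult_plus_distr_r.
destruct (Nat.le_gt_cases k X) as [HkX|HkX].
- assert (E := T_diff_le n (k - n) (/ b n) ltac:(intros; apply Hmono; lia)).
  replace (n + (k - n))%nat with k in E by lia.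
  assert (INR (k - n) <= INR X) by (apply le_INR; lia). nra.
- assert (E := T_diff_le n (X - n) (/ b n) ltac:(intros; apply Hmono; lia)).
  replace (n + (X - n))%nat with X in E by lia.
  assert (INR (X - n) <= INR X) by (apply le_INR; lia).
  assert (G := T_diff_geom X (k - X) ltac:(intros; apply H; lia)).
  replace (X + (k - X))%nat with k in G by lia.
  assert (0 < 2 / 2 ^ k) by (apply Rdiv_lt_0_compat; [lra | apply pow2_pos]).
  assert (2 / 2 ^ X <= 4 * / b n).
  { simpl in HX2. assert (Hp := pow2_pos X).
    replace (2 / 2 ^ X) with (4 * / (2 * 2 ^ X)) by (field; lra).
    apply Rmult_le_compat_l; [lra|]. apply Rinv_le_contravar; lra. }
  nra.
Qed.

(** From t = n0 + 1 on all steps are small, so u n / F n never exceeds the potential at t. Since ln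
    (b n) <= u (n+1), this contradicts [b_limsup] with that potential as K. *)
Lemma not_eventually_exponential n0 : ~ (forall n, (n0 <= n)%nat -> 2 ^ n < b n).
Proof.
intros H. set (t := S n0).
assert (Hs : forall m, (t <= m)%nat -> small_step m).
{ intros m Hm. unfold small_step.
  (* [T_block_le] holds for every right end of the block, and T tends to 0 there. *)
  assert (HT : T m <= (2 * ln (b m) + 4) / b m).
  { apply Rnot_lt_le. intros C.
    destruct (T_lim (T m - (2 * ln (b m) + 4) / b m) ltac:(lra)) as [N HN].
    assert (E := T_block_le m (m + N) ltac:(lia) ltac:(intros; apply H; lia)).
    specialize (HN (m + N)%nat ltac:(lia)). lra. }
  assert (HL := T_lower m). assert (He := exp_pos (q m * u m)).
  assert (0 < (2 * ln (b m) + 4) / b m).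
  { assert (Hl := ln_b_ge0 m). assert (Hb := b_ge1 m). apply Rdiv_lt_0_compat; lra. }
  unfold Rdiv in *. rewrite Rmult_assoc. nra. }
destruct (b_limsup (potential t) t) as [n [Hn Hb]].
assert (E1 := potential_mono t (S n) ltac:(lia) ltac:(intros; apply Hs; lia)).
assert (E2 := ratio_le_potential (S n) ltac:(lia)).
assert (HF := F_pos (S n) ltac:(lia)).
assert (E3 : u (S n) <= potential t * F (S n)).
{ replace (u (S n)) with (u (S n) / F (S n) * F (S n)) by (field; lra).
  apply Rmult_le_compat_r; lra. }
rewrite u_rec in E3. assert (Hu := u_ge0 n). lra.
Qed.

Lemma T_tail n : (N0 <= n)%nat -> (1 <= n)%nat -> T n <= / eps * Rpower (INR n) (- eps).
Proof.
intros HN Hn.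
assert (Hie : 0 < / eps) by (apply Rinv_0_lt_compat; lra).
assert (H : forall j, T n - T (n + j) <=
   / eps * (Rpower (INR n) (- eps) - Rpower (INR (n + j)) (- eps))).
{ induction j as [|j IH]; [rewrite Nat.add_0_r; lra|].
  replace (n + S j)%nat with (S (n + j)) by lia.
  assert (E := T_rec (n + j)).
  assert (G := inv_le_telescope eps (n + j) _ eps_pos ltac:(lia) (b_growth (n + j) ltac:(lia))).
  lra. }
apply Rnot_lt_le. intros C.
destruct (T_lim (T n - / eps * Rpower (INR n) (- eps)) ltac:(lra)) as [N HN'].
specialize (HN' (n + N)%nat ltac:(lia)). specialize (H N).
assert (0 < Rpower (INR (n + N)) (- eps)) by apply exp_pos. nra.
Qed.

(* Split the tail at y = (b k)^(1/(1+eps)): monotonicity bounds the terms before y,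
   [T_tail] the terms after y. *)
Lemma T_power k : (N0 <= k)%nat ->
  T k <= (2 + / eps) * exp (- (eps / (1 + eps)) * ln (b k)).
Proof.
intros Hk. assert (Hb := b_ge1 k).
assert (Hie : 0 < / eps) by (apply Rinv_0_lt_compat; lra).
set (y := exp (ln (b k) / (1 + eps))).
assert (Hy0 : 0 < y) by apply exp_pos.
assert (Hyl : ln y = ln (b k) / (1 + eps)) by apply ln_exp.
assert (Hy : INR k + 1 <= y).
{ assert (G := b_growth k Hk). rewrite <- S_INR.
  assert (HI : 0 < INR (S k)) by (apply lt_0_INR; lia).
  assert (HL : ln (INR (S k)) <= ln y).
  { rewrite Hyl. apply Rmult_le_reg_r with (1 + eps); [lra|].
    replace (ln (b k) / (1 + eps) * (1 + eps)) with (ln (b k)) by (field; lra).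
    unfold Rpower in G.
    destruct (Rle_or_lt (ln (INR (S k)) * (1 + eps)) (ln (b k))) as [|C]; [assumption|].
    apply exp_increasing in C. rewrite exp_ln in C by lra.
    rewrite Rmult_comm in C. lra. }
  apply Rnot_lt_le. intros C. apply ln_increasing in C; lra. }
assert (Hyb : exp (- (eps / (1 + eps)) * ln (b k)) = Rpower y (- eps)).
{ unfold Rpower. rewrite Hyl. f_equal. field. lra. }
assert (Hyb2 : y / b k = Rpower y (- eps)).
{ unfold Rpower. rewrite Hyl.
  replace (- eps * (ln (b k) / (1 + eps))) with (ln (b k) / (1 + eps) + - ln (b k)) by (field; lra).
  rewrite exp_plus, exp_Ropp, exp_ln by lra. reflexivity. }
rewrite Hyb.
assert (HX : exists X, y <= INR X <= y + 1).
{ destruct (archimed y) as [A1 A2]. exists (Z.to_nat (up y)).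
  assert (0 < up y)%Z by (apply lt_IZR; simpl; lra).
  rewrite INR_IZR_INZ, Z2Nat.id by lia. lra. }
destruct HX as [X [HX1 HX2]].
assert (HkX : (S k <= X)%nat) by (apply INR_le; rewrite S_INR; lra).
assert (HI := pos_INR k).
assert (E1 := T_diff_le k (X - k) (/ b k)
  ltac:(intros m Hm; apply Rinv_le_contravar; [lra | apply b_mono; lia])).
replace (k + (X - k))%nat with X in E1 by lia.
assert (E2 := T_tail X ltac:(lia) ltac:(lia)).
assert (E3 : Rpower (INR X) (- eps) <= Rpower y (- eps)).
{ rewrite !Rpower_Ropp. apply Rinv_le_contravar; [apply exp_pos|].
  apply Rle_Rpower_l; lra. }
(* There are at most X <= y + 1 <= 2 y terms, each at most 1 / b k. *)
assert (E4 : INR (X - k) * / b k <= 2 * Rpower y (- eps)).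
{ rewrite <- Hyb2. unfold Rdiv. rewrite <- Rmult_assoc.
  apply Rmult_le_compat_r; [left; apply Rinv_0_lt_compat; lra|].
  assert (INR (X - k) <= INR X) by (apply le_INR; lia). lra. }
nra.
Qed.

(** By monotonicity every earlier term is at most 2^n too, so each of the n + 1 logarithms is at
    most n. *)
Lemma u_le_of_b n : b n <= 2 ^ n -> u (S n) <= u 0 + INR (S n) * INR n.
Proof.
intros Hb.
assert (Hl : forall m, (m <= n)%nat -> ln (b m) <= INR n).
{ intros m Hm. assert (b m <= exp (INR n)).
  { eapply Rle_trans; [apply b_mono, Hm|]. eapply Rle_trans; [exact Hb|apply pow2_le_exp]. }
  rewrite <- (ln_exp (INR n)). assert (Hm1 := b_ge1 m).
  destruct H as [H|H]; [left; apply ln_increasing; lra | rewrite H; lra]. }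
assert (H : forall j, (j <= S n)%nat -> u j <= u 0 + INR j * INR n).
{ induction j as [|j IH]; intros Hj; [simpl; lra|].
  rewrite u_rec, S_INR. specialize (IH ltac:(lia)). specialize (Hl j ltac:(lia)). lra. }
apply H. lia.
Qed.

Lemma F_mono n m : (1 <= n)%nat -> (n <= m)%nat -> F n <= F m.
Proof.
intros Hn Hnm. induction Hnm as [|m Hnm IH]; [lra|].
assert (H := F_rec m ltac:(lia)). assert (HF := F_pos m ltac:(lia)).
assert (Hq := q_ge0 m). nra.
Qed.

(** The numerator is quadratic in t, so this fails once tau is large. *)
Lemma decay_bound tau : (N0 <= tau)%nat -> b tau <= 2 ^ tau ->
  exists t, (tau < t)%nat /\
  eps / (1 + eps) <=
    (Rabs (ln (2 * (2 + / eps))) + 3 * (u 0 + INR t ^ 2) + 3 * (INR t + 5)) / 2 ^ (t - 1).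
Proof.
intros HN Htau. set (dl := eps / (1 + eps)). set (cT := 2 + / eps).
assert (Hie : 0 < / eps) by (apply Rinv_0_lt_compat; lra).
assert (Hdl : 0 < dl) by (apply Rdiv_lt_0_compat; lra).
(* [k] is a step with ln (b k) > F (k+1), and [s] the last index before it with b s <= 2^s. So u is
   small at t = s + 1, and b m > 2^m throughout the block from t to k. *)
destruct (b_limsup 1 (S tau)) as [k [Hk Hbk]].
destruct (last_before (fun m => b m <= 2 ^ m) tau k ltac:(lia) Htau) as [s [Hs [Hbs Hsk]]].
set (t := S s).
assert (Hbig : forall m, (t <= m < k)%nat -> 2 ^ m < b m).
{ intros m Hm. apply Rnot_le_lt. apply Hsk. unfold t in Hm. lia. }
assert (HTk := T_power k ltac:(lia)). fold dl cT in HTk.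
set (z := exp (- dl * ln (b k))) in *.
assert (Hz : 0 < z) by apply exp_pos.
(* [n] is the first index at which the tail bound [cT * z] at k can carry half of what [T_lower]
   demands; k itself qualifies. Before n the other half falls on the block, so the steps are
   small. *)
destruct (first_from (fun n => 1 <= 2 * cT * z * exp (q n * u n)) t k) as [n [Hn [Pn Hfirst]]].
{ unfold t; lia. }
{ assert (HL := T_lower k). assert (He := exp_pos (q k * u k)).
  assert (0 <= exp (q k * u k) * (cT * z - T k)) by (apply Rmult_le_pos; lra).
  assert (0 < exp (q k * u k) * (cT * z))
    by (apply Rmult_lt_0_compat; [|apply Rmult_lt_0_compat]; unfold cT; lra).
  lra. }
assert (Hsteps : forall m, (t <= m < n)%nat -> small_step m).
{ intros m Hm. assert (C := Hfirst m Hm). apply Rnot_le_lt in C.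
  unfold small_step. assert (HL := T_lower m).
  assert (HB := T_block_le m k ltac:(lia) ltac:(intros; apply Hbig; lia)).
  assert (He := exp_pos (q m * u m)).
  assert (exp (q m * u m) * T m <=
     exp (q m * u m) * ((2 * ln (b m) + 4) / b m + cT * z))
    by (apply Rmult_le_compat_l; lra).
  unfold Rdiv in *. lra. }
assert (Ht : (1 <= t)%nat) by (unfold t; lia).
assert (V1 := potential_mono t n ltac:(lia) Hsteps).
assert (V2 := ratio_le_potential n ltac:(lia)).
assert (V3 := potential_le t Ht).
set (V := 3 * (u t / F t + excess t)) in *.
assert (HFn := F_pos n ltac:(lia)). assert (HFk := F_pos (S k) ltac:(lia)).
assert (Hq := q_ge0 n). assert (Hu := u_ge0 n).
assert (V4 : q n * u n <= F (S k) * V).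
{ assert (HFr := F_rec n ltac:(lia)). assert (HFm := F_mono (S n) (S k) ltac:(lia) ltac:(lia)).
  assert (Hv : 0 <= u n / F n) by (apply Rmult_le_pos; [lra | left; apply Rinv_0_lt_compat; lra]).
  replace (q n * u n) with (q n * F n * (u n / F n)) by (field; lra).
  apply Rmult_le_compat; try lra. apply Rmult_le_pos; lra. }
assert (E1 : dl * ln (b k) <= ln (2 * cT) + q n * u n).
{ assert (Hc : 0 < 2 * cT) by (unfold cT; lra).
  assert (L : ln 1 <= ln (2 * cT * z * exp (q n * u n))).
  { destruct Pn as [Pn|Pn]; [left; apply ln_increasing; lra | rewrite <- Pn; lra]. }
  assert (Hcz : 0 < 2 * cT * z) by (apply Rmult_lt_0_compat; assumption).
  rewrite ln_1, (ln_mult (2 * cT * z)), (ln_mult (2 * cT) z) in L;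
    try apply exp_pos; try assumption.
  unfold z in L. rewrite !ln_exp in L. lra. }
(* Here ln (b k) > F (k+1) enters; dividing by F (k+1) will set the fixed [dl] against the small
   [V]. *)
assert (E2 : dl * F (S k) <= Rabs (ln (2 * cT)) + F (S k) * V).
{ assert (A := Rle_abs (ln (2 * cT))). nra. }
assert (HF2 : 2 ^ (t - 1) <= F (S k)).
{ eapply Rle_trans; [apply F_ge, Ht | apply F_mono; lia]. }
assert (Hp := pow2_pos (t - 1)).
assert (E3 : dl <= Rabs (ln (2 * cT)) / 2 ^ (t - 1) + V).
{ apply Rle_trans with (Rabs (ln (2 * cT)) / F (S k) + V).
  - apply Rmult_le_reg_r with (F (S k)); [lra|].
    replace ((Rabs (ln (2 * cT)) / F (S k) + V) * F (S k))
      with (Rabs (ln (2 * cT)) + F (S k) * V) by (field; lra). lra.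
  - apply Rplus_le_compat_r. apply Rmult_le_compat_l; [apply Rabs_pos|].
    apply Rinv_le_contravar; lra. }
exists t. split; [unfold t; lia|]. fold cT.
eapply Rle_trans; [exact E3|]. unfold V, excess.
assert (U := u_le_of_b s Hbs). fold t in U.
assert (Hst : INR t = INR s + 1) by (unfold t; apply S_INR).
assert (HI := pos_INR s).
assert (U2 : u t / F t <= (u 0%nat + INR t ^ 2) / 2 ^ (t - 1)).
{ assert (HFt := F_pos t Ht). assert (HFg := F_ge t Ht).
  apply Rle_trans with (u t / 2 ^ (t - 1)).
  - apply Rmult_le_compat_l; [apply u_ge0 | apply Rinv_le_contravar; lra].
  - apply Rmult_le_compat_r; [left; apply Rinv_0_lt_compat; lra|].
    replace (INR t ^ 2) with (INR t * INR t) by ring.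
    assert (INR t * INR s <= INR t * INR t) by (apply Rmult_le_compat_l; lra). lra. }
replace (2 ^ t) with (2 * 2 ^ (t - 1)) by (unfold t; simpl; rewrite Nat.sub_0_r; ring).
replace (2 * (INR t + 5) / (2 * 2 ^ (t - 1))) with ((INR t + 5) / 2 ^ (t - 1)) by (field; lra).
unfold Rdiv in *. rewrite !Rmult_plus_distr_r. lra.
Qed.

Theorem growth_contradiction : False.
Proof.
set (dl := eps / (1 + eps)).
assert (Hdl : 0 < dl) by (apply Rdiv_lt_0_compat; lra).
set (A := Rabs (ln (2 * (2 + / eps))) + 3 * u 0%nat + 15).
assert (HA : 0 < A) by (unfold A; generalize (Rabs_pos (ln (2 * (2 + / eps)))) (u_ge0 0); lra).
(* In terms of 2^(t-1), [cube_le_pow2] has the constant 54, and (A + 6) t^2 bounds the numerator in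
   [decay_bound]. Together they give dl t <= 54 (A + 6), which t > N1 excludes. *)
destruct (INR_unbounded (54 * (A + 6) / dl)) as [N1 HN1].
destruct (classic (exists tau, (Nat.max N0 N1 <= tau)%nat /\ b tau <= 2 ^ tau))
  as [[tau [Htau Hb]]|C].
- destruct (decay_bound tau ltac:(lia) Hb) as [t [Ht E]]. fold dl in E.
  assert (Ht1 : 1 <= INR t) by (apply (le_INR 1); lia).
  assert (HtN : INR N1 <= INR t) by (apply le_INR; lia).
  assert (Hc := cube_le_pow2 t).
  assert (Hp := pow2_pos (t - 1)).
  replace (2 ^ t) with (2 * 2 ^ (t - 1)) in Hc
    by (destruct t as [|t']; [lia | simpl; rewrite Nat.sub_0_r; ring]).
  assert (E' : dl * 2 ^ (t - 1) <= (A + 6) * INR t ^ 2).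
  { apply (Rmult_le_compat_r (2 ^ (t - 1))) in E; [|lra].
    match type of E with _ <= ?X / _ * _ =>
      replace (X / 2 ^ (t - 1) * 2 ^ (t - 1)) with X in E by (field; lra) end.
    eapply Rle_trans; [exact E|]. unfold A.
    assert (0 <= Rabs (ln (2 * (2 + / eps)))) by apply Rabs_pos.
    assert (Hu := u_ge0 0). assert (Hsq : INR t <= INR t ^ 2) by (simpl; nra).
    assert (0 <= (Rabs (ln (2 * (2 + / eps))) + 3 * u 0%nat) * (INR t ^ 2 - 1))
      by (apply Rmult_le_pos; lra).
    lra. }
  assert (E2 : dl * INR t ^ 3 <= 54 * (A + 6) * INR t ^ 2).
  { apply (Rmult_le_compat_l dl) in Hc; lra. }
  assert (E3 : 54 * (A + 6) < dl * INR t).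
  { replace (54 * (A + 6)) with (dl * (54 * (A + 6) / dl)) by (field; lra).
    apply Rmult_lt_compat_l; lra. }
  assert (0 < INR t ^ 2) by (apply pow_lt; lra).
  assert (54 * (A + 6) * INR t ^ 2 < dl * INR t * INR t ^ 2) by (apply Rmult_lt_compat_r; lra).
  simpl in *. lra.
- apply (not_eventually_exponential (Nat.max N0 N1)). intros n Hn.
  apply Rnot_le_lt. intros Hb. apply C. exists n. split; assumption.
Qed.

End Analysis.

(** * Convergence and the main theorem *)

Lemma alg_deg_pos z k : alg_deg z k -> (1 <= k)%nat.
Proof.
destruct k as [|k]; [|lia]. intros [[p [Hp [Hl Hz]]] _]. exfalso.
destruct p as [|c [|c' p]]; simpl in Hl; try lia.
unfold proot, peval, Cadd, Cmul, ZtoC in Hz. simpl in Hz. injection Hz as Hz _.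
apply Exists_cons in Hp. destruct Hp as [Hp|Hp]; [|inversion Hp].
apply Hp, eq_IZR. lra.
Qed.

Lemma Cnorm_pos z : z <> (0, 0) -> 0 < Cnorm z.
Proof.
destruct z as [x y]. intros H. unfold Cnorm; simpl. apply sqrt_lt_R0.
destruct (Req_dec x 0) as [->|Hx].
- destruct (Req_dec y 0) as [->|Hy]; [contradiction|].
  assert (0 < y * y) by (apply Rsqr_pos_lt; assumption). lra.
- assert (0 < x * x) by (apply Rsqr_pos_lt; assumption).
  assert (0 <= y * y) by apply Rle_0_sqr. lra.
Qed.

Lemma Cnorm_sqr z : Cnorm z * Cnorm z = fst z * fst z + snd z * snd z.
Proof.
apply sqrt_sqrt. generalize (Rle_0_sqr (fst z)) (Rle_0_sqr (snd z)). unfold Rsqr. lra.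
Qed.

Lemma Cnorm_le_abs z : Cnorm z <= Rabs (fst z) + Rabs (snd z).
Proof.
apply Rsqr_incr_0_var; [|generalize (Rabs_pos (fst z)) (Rabs_pos (snd z)); lra].
unfold Rsqr. rewrite Cnorm_sqr.
rewrite <- (Rabs_pos_eq (fst z * fst z)), <- (Rabs_pos_eq (snd z * snd z)), !Rabs_mult
  by apply Rle_0_sqr.
generalize (Rabs_pos (fst z)) (Rabs_pos (snd z)). nra.
Qed.

Lemma abs_div_sqr_le x n : 0 < n -> x * x <= n * n -> Rabs (x / (n * n)) <= / n.
Proof.
intros Hn Hx. unfold Rdiv. rewrite Rabs_mult, (Rabs_pos_eq (/ (n * n)))
  by (left; apply Rinv_0_lt_compat; nra).
assert (Rabs x <= n).
{ apply Rsqr_incr_0_var; [|lra]. rewrite <- Rsqr_abs. exact Hx. }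
apply Rmult_le_reg_r with (n * n); [nra|].
rewrite Rmult_assoc, Rinv_l by nra. replace (/ n * (n * n)) with n by (field; lra). lra.
Qed.

Lemma Cre_Cinv_le z : z <> (0, 0) -> Rabs (Cre (Cinv z)) <= / Cnorm z.
Proof.
intros H. unfold Cre, Cinv; simpl. rewrite <- Cnorm_sqr.
apply abs_div_sqr_le; [apply Cnorm_pos, H|]. rewrite Cnorm_sqr.
generalize (Rle_0_sqr (snd z)). unfold Rsqr. lra.
Qed.

Lemma Cim_Cinv_le z : z <> (0, 0) -> Rabs (Cim (Cinv z)) <= / Cnorm z.
Proof.
intros H. unfold Cim, Cinv; simpl. rewrite <- Cnorm_sqr.
apply abs_div_sqr_le; [apply Cnorm_pos, H|]. rewrite Cnorm_sqr.
generalize (Rle_0_sqr (fst z)). unfold Rsqr. lra.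
Qed.

(** * Partial sums, limits and tails of series *)

Lemma fst_Csum_lt f n : fst (Csum_lt f n) = sum_lt (fun k => Cre (f k)) n.
Proof. induction n as [|n IH]; simpl; [reflexivity|]. rewrite IH. reflexivity. Qed.

Lemma snd_Csum_lt f n : snd (Csum_lt f n) = sum_lt (fun k => Cim (f k)) n.
Proof. induction n as [|n IH]; simpl; [reflexivity|]. rewrite IH. reflexivity. Qed.

Lemma sum_f_R0_sum_lt x n : sum_f_R0 x n = sum_lt x (S n).
Proof. induction n as [|n IH]; simpl; [ring|]. rewrite IH. reflexivity. Qed.

Lemma infinite_sum_of_cv x X : Un_cv (sum_lt x) X -> infinite_sum x X.
Proof.
intros H e He. destruct (H e He) as [N HN]. exists N. intros n Hn.
rewrite sum_f_R0_sum_lt. apply HN. lia.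
Qed.

Lemma sum_lt_growing x : (forall n, 0 <= x n) -> Un_growing (sum_lt x).
Proof. intros H n. simpl. specialize (H n). lra. Qed.

Lemma sum_lt_bounded_cv x B : (forall n, 0 <= x n) -> (forall n, sum_lt x n <= B) ->
  exists X, Un_cv (sum_lt x) X.
Proof.
intros H0 HB. destruct (growing_cv (sum_lt x)) as [X HX].
- apply sum_lt_growing, H0.
- exists B. intros y [n ->]. apply HB.
- exists X. exact HX.
Qed.

(** x is written as (x + y) - y, a difference of two series with nonnegative terms and bounded
    partial sums. *)
Lemma sum_lt_abs_cv x y B : (forall n, Rabs (x n) <= y n) -> (forall n, sum_lt y n <= B) ->
  exists X, Un_cv (sum_lt x) X.
Proof.
intros Hxy HB.
assert (Hb : forall n, - y n <= x n <= y n).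
{ intros n. specialize (Hxy n).
  generalize (Rle_abs (x n)) (Rle_abs (- x n)). rewrite Rabs_Ropp. lra. }
destruct (sum_lt_bounded_cv y B) as [Y HY]; [intros n; specialize (Hb n); lra | exact HB |].
assert (Es : forall n, sum_lt (fun k => x k + y k) n = sum_lt x n + sum_lt y n).
{ induction n as [|n IH]; simpl; [ring | rewrite IH; ring]. }
assert (El : forall n, sum_lt x n <= sum_lt y n).
{ induction n as [|n IH]; simpl; [lra | specialize (Hb n); lra]. }
destruct (sum_lt_bounded_cv (fun k => x k + y k) (2 * B)) as [Z HZ].
- intros n. specialize (Hb n). lra.
- intros n. rewrite Es. specialize (HB n). specialize (El n). lra.
- exists (Z - Y). intros e He. destruct (CV_minus _ _ _ _ HZ HY e He) as [N HN].
  exists N. intros n Hn. specialize (HN n Hn). rewrite Es in HN.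
  replace (sum_lt x n) with (sum_lt x n + sum_lt y n - sum_lt y n) by ring. exact HN.
Qed.

Lemma sum_lt_tail_le x y X Y n : (forall k, Rabs (x k) <= y k) ->
  Un_cv (sum_lt x) X -> Un_cv (sum_lt y) Y -> Rabs (X - sum_lt x n) <= Y - sum_lt y n.
Proof.
intros Hxy HX HY.
assert (Hj : forall j, Rabs (sum_lt x (n + j) - sum_lt x n) <= sum_lt y (n + j) - sum_lt y n).
{ induction j as [|j IH].
  - rewrite Nat.add_0_r, !Rminus_diag, Rabs_R0. lra.
  - replace (n + S j)%nat with (S (n + j)) by lia. simpl.
    replace (sum_lt x (n + j) + x (n + j)%nat - sum_lt x n)
      with (sum_lt x (n + j) - sum_lt x n + x (n + j)%nat) by ring.
    eapply Rle_trans; [apply Rabs_triang|]. specialize (Hxy (n + j)%nat). lra. }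
apply Rnot_lt_le. intros C.
set (e := (Rabs (X - sum_lt x n) - (Y - sum_lt y n)) / 2).
assert (He : 0 < e) by (unfold e; lra).
destruct (HX e He) as [N1 HN1]. destruct (HY e He) as [N2 HN2].
specialize (HN1 (n + (N1 + N2))%nat ltac:(lia)).
specialize (HN2 (n + (N1 + N2))%nat ltac:(lia)). specialize (Hj (N1 + N2)%nat).
unfold Rdist in *. apply Rabs_def2 in HN2.
assert (Rabs (X - sum_lt x n) <= Rabs (sum_lt x (n + (N1 + N2)) - sum_lt x n)
  + Rabs (sum_lt x (n + (N1 + N2)) - X)).
{ rewrite (Rabs_minus_sym _ X).
  replace (X - sum_lt x n) with
    (sum_lt x (n + (N1 + N2)) - sum_lt x n + (X - sum_lt x (n + (N1 + N2)))) at 1 by ring.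
  apply Rabs_triang. }
unfold e in *. lra.
Qed.

Lemma sum_lt_pos_lt_lim x X n : (forall k, 0 < x k) -> Un_cv (sum_lt x) X -> sum_lt x n < X.
Proof.
intros H HX.
assert (G := growing_ineq (sum_lt x) X (sum_lt_growing x (fun k => Rlt_le _ _ (H k))) HX (S n)).
simpl in G. specialize (H n). lra.
Qed.

Lemma sum_lt_opp x n : sum_lt (fun k => - x k) n = - sum_lt x n.
Proof. induction n as [|n IH]; simpl; [ring | rewrite IH; ring]. Qed.

Lemma inv_power_summable eps b N0 : 0 < eps -> (forall n, 0 < b n) ->
  (forall n, (N0 <= n)%nat -> Rpower (INR (S n)) (1 + eps) <= b n) ->
  exists B, forall n, sum_lt (fun k => / b k) n <= B.
Proof.
intros He Hb Hg. set (N := S N0).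
assert (Hie : 0 < / eps) by (apply Rinv_0_lt_compat; lra).
assert (H : forall j, sum_lt (fun k => / b k) (N + j) <= sum_lt (fun k => / b k) N +
   / eps * (Rpower (INR N) (- eps) - Rpower (INR (N + j)) (- eps))).
{ induction j as [|j IH]; [rewrite Nat.add_0_r; lra|].
  replace (N + S j)%nat with (S (N + j)) by lia. cbn [sum_lt].
  assert (G := inv_le_telescope eps (N + j) _ He ltac:(lia) (Hg (N + j)%nat ltac:(lia))).
  lra. }
exists (sum_lt (fun k => / b k) N + / eps * Rpower (INR N) (- eps)). intros n.
apply Rle_trans with (sum_lt (fun k => / b k) (N + n)).
- assert (G := sum_lt_growing (fun k => / b k) (fun k => Rlt_le _ _ (Rinv_0_lt_compat _ (Hb k)))).
  apply Rge_le, growing_prop; [exact G | lia].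
- eapply Rle_trans; [apply H|].
  assert (0 < Rpower (INR (N + n)) (- eps)) by apply exp_pos. nra.
Qed.

(** * The exponents of the limsup condition *)

Lemma prodterm_S d n : (1 <= n)%nat -> prodterm d (S n) = (prodterm d n * (d ^ n + d))%nat.
Proof.
intros Hn. unfold prodterm.
replace (S n - 1)%nat with (S (n - 1)) by lia.
rewrite seq_S, map_app, fold_right_app.
replace (1 + (n - 1))%nat with n by lia. cbn [map fold_right].
generalize (map (fun i => (d ^ i + d)%nat) (seq 1 (n - 1))). intros l.
induction l as [|x l IH]; cbn [fold_right]; [ring | rewrite IH; ring].
Qed.

(** Without the common factor this is 1 + D d^n <= D (d^n + d), which holds as D d >= 1. *)
Lemma exponent_rec d D n : (1 <= d)%nat -> (1 <= D)%nat -> (1 <= n)%nat ->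
  (1 + INR (D * d ^ n)) * INR (D ^ n * prodterm d n) <= INR (D ^ S n * prodterm d (S n)).
Proof.
intros Hd HD Hn. rewrite <- S_O_plus_INR, <- mult_INR. apply le_INR.
rewrite prodterm_S by assumption.
replace (D ^ S n * (prodterm d n * (d ^ n + d)))%nat
  with (D * (d ^ n + d) * (D ^ n * prodterm d n))%nat by (simpl; ring).
apply Nat.mul_le_mono_r. nia.
Qed.

Lemma exponent_ge d D n : (1 <= d)%nat -> (1 <= D)%nat -> (1 <= n)%nat ->
  2 ^ (n - 1) <= INR (D ^ n * prodterm d n).
Proof.
intros Hd HD Hn. induction Hn as [|n Hn IH].
- simpl. apply (le_INR 1). unfold prodterm. simpl. nia.
- eapply Rle_trans; [|apply exponent_rec; assumption].
  assert (1 <= INR (D * d ^ n)).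
  { apply (le_INR 1). assert (d ^ n <> 0)%nat by (apply Nat.pow_nonzero; lia). nia. }
  replace (S n - 1)%nat with (S (n - 1)) by lia. simpl (2 ^ S (n - 1)).
  assert (0 < 2 ^ (n - 1)) by (apply pow_lt; lra). nra.
Qed.

Theorem theorem1p1 (d D : nat) (eps : R) (alpha : nat -> Cx)
  (Heps : 0 < eps)
  (Hint : forall n, (1 <= n)%nat -> alg_integer (alpha n))
  (* (i) max_n deg alpha_n = d *)
  (Hdeg_le : forall n, (1 <= n)%nat -> exists k, (k <= d)%nat /\ alg_deg (alpha n) k)
  (Hdeg_max : exists n, (1 <= n)%nat /\ alg_deg (alpha n) d)
  (* (ii) |alpha_n| is the house of alpha_n *)
  (Hhouse : forall n, (1 <= n)%nat -> house (alpha n) (Cnorm (alpha n)))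
  (* (iii) |alpha_n| non-decreasing *)
  (Hmono : forall n m, (1 <= n)%nat -> (n <= m)%nat ->
             Cnorm (alpha n) <= Cnorm (alpha m))
  (* (iv) |alpha_n| >= n^(1+eps) for n large *)
  (Hgrowth : exists N, forall n, (N <= n)%nat -> (1 <= n)%nat ->
             Rpower (INR n) (1 + eps) <= Cnorm (alpha n))
  (* (v) *)
  (Hpos : (forall n, (1 <= n)%nat -> 0 < Cre (alpha n)) \/
          (forall n, (1 <= n)%nat -> 0 < Cim (alpha n)))
  (* (vi) limsup_n house(alpha_n)^(1/(D^n prod_{i=1}^{n-1}(d^i+d))) = infinity *)
  (Hlimsup : forall h : nat -> R,
     (forall n, (1 <= n)%nat -> house (alpha n) (h n)) ->
     forall (M : R) (N : nat), exists n, (N <= n)%nat /\ (1 <= n)%nat /\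
       M < Rpower (h n) (/ INR (D ^ n * prodterm d n)%nat)) :
  exists s : Cx,
    infinite_sum (fun k => Cre (Cinv (alpha (S k)))) (Cre s) /\
    infinite_sum (fun k => Cim (Cinv (alpha (S k)))) (Cim s) /\
    deg_gt s D.
Proof.
destruct Hgrowth as [N0 Hg].
set (b := fun n => Cnorm (alpha (S n))).
assert (Ha0 : forall n, alpha (S n) <> (0, 0)).
{ intros n E. destruct Hpos as [H|H]; specialize (H (S n) ltac:(lia));
    rewrite E in H; unfold Cre, Cim in H; simpl in H; lra. }
assert (Hb0 : forall n, 0 < b n) by (intros n; apply Cnorm_pos, Ha0).
assert (Hbg : forall n, (N0 <= n)%nat -> Rpower (INR (S n)) (1 + eps) <= b n).
{ intros n Hn. apply Hg; lia. }
destruct (inv_power_summable eps b N0 Heps Hb0 Hbg) as [BS HBS].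
set (y := fun k => / b k).
assert (Hy0 : forall n, 0 <= y n) by (intros n; left; apply Rinv_0_lt_compat, Hb0).
destruct (sum_lt_bounded_cv y BS Hy0 HBS) as [Y HY].
set (x1 := fun k => Cre (Cinv (alpha (S k)))).
set (x2 := fun k => Cim (Cinv (alpha (S k)))).
assert (Hx1 : forall k, Rabs (x1 k) <= y k) by (intros k; apply Cre_Cinv_le, Ha0).
assert (Hx2 : forall k, Rabs (x2 k) <= y k) by (intros k; apply Cim_Cinv_le, Ha0).
destruct (sum_lt_abs_cv x1 y BS Hx1 HBS) as [X1 HX1].
destruct (sum_lt_abs_cv x2 y BS Hx2 HBS) as [X2 HX2].
exists (X1, X2). split; [apply infinite_sum_of_cv, HX1|].
split; [apply infinite_sum_of_cv, HX2|].
intros [k [HkD Hk]].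
assert (HD : (1 <= D)%nat) by (apply alg_deg_pos in Hk; lia).
assert (Hd : (1 <= d)%nat) by (destruct Hdeg_max as [n [_ H]]; apply (alg_deg_pos _ _ H)).
destruct (@Liouville.liouville d D k (fun n => alpha (S n)) (X1, X2))
  as [Hb1 [c [B [Hc HL]]]]; auto.
1-3: intros n; first [apply Hint | apply Hdeg_le | apply Hhouse]; lia.
set (M := Rmax 1 (B + Y)).
assert (HM1 : 1 <= M) by apply Rmax_l.
assert (Hsum : forall n, sum_lt y n <= Y).
{ intros n. apply growing_ineq; [apply sum_lt_growing, Hy0 | exact HY]. }
set (T := fun n => Y - sum_lt y n).
(* Real and imaginary part of the remainder are each at most [T n], whence a factor 2; it can sit
   inside the power because the exponent D d^n is at least 1. *)
set (C := 2 * (c * M)).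
assert (HcM : 1 <= c * M) by nra.
set (P := prod_lt b).
assert (HP : forall n, 1 <= P n).
{ induction n as [|n IH]; [unfold P; simpl; lra|].
  change (P (S n)) with (P n * b n). specialize (Hb1 n). change (1 <= b n) in Hb1. nra. }
(* By (v) the inverses all have positive real part or all have negative imaginary part, so no
   partial sum equals the limit. *)
assert (Hneq : forall n, (X1, X2) <> Csum_lt (fun n => Cinv (alpha (S n))) n).
{ intros n E. destruct Hpos as [H|H].
  - assert (L : sum_lt x1 n < X1).
    { apply sum_lt_pos_lt_lim; [|exact HX1]. intros j. unfold x1, Cre, Cinv. simpl.
      rewrite <- Cnorm_sqr. specialize (Hb0 j). unfold b in Hb0.
      apply Rdiv_lt_0_compat; [apply H; lia | nra]. }
    apply (f_equal fst) in E. rewrite fst_Csum_lt in E. change (X1 = sum_lt x1 n) in E. lra.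
  - assert (L : sum_lt (fun j => - x2 j) n < - X2).
    { apply sum_lt_pos_lt_lim.
      - intros j. unfold x2, Cim, Cinv. simpl. rewrite <- Cnorm_sqr.
        specialize (Hb0 j). unfold b in Hb0. unfold Rdiv.
        rewrite <- Ropp_mult_distr_l, Ropp_involutive.
        apply Rdiv_lt_0_compat; [apply H; lia | nra].
      - intros e He. destruct (HX2 e He) as [N HN]. exists N. intros m Hm.
        rewrite sum_lt_opp. unfold Rdist. specialize (HN m Hm). unfold Rdist in HN.
        rewrite Rabs_minus_sym. replace (- X2 - - sum_lt x2 m) with (sum_lt x2 m - X2) by ring.
        exact HN. }
    rewrite sum_lt_opp in L.
    apply (f_equal snd) in E. rewrite snd_Csum_lt in E. change (X2 = sum_lt x2 n) in E. lra. }
assert (HcMP : forall n, 1 <= c * M * P n) by (intros n; specialize (HP n); nra).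
assert (HCP : forall n, 1 <= C * P n) by (intros n; specialize (HcMP n); unfold C; lra).
apply (growth_contradiction eps b T (fun n => ln (C * P n)) (fun n => INR (D * d ^ n))
  (fun n => INR (D ^ n * prodterm d n)) N0); auto.
- intros n m Hnm. apply Hmono; lia.
- intros n. unfold T. simpl. unfold y. ring.
- intros e He. destruct (HY e He) as [N HN]. exists N. intros n Hn. specialize (HN n Hn).
  unfold Rdist in HN. apply Rabs_def2 in HN. unfold T. lra.
- intros n. rewrite <- ln_1.
  destruct (HCP n) as [H|H]; [left; apply ln_increasing; lra | rewrite <- H; lra].
- intros n. change (P (S n)) with (P n * b n).
  rewrite <- Rmult_assoc, ln_mult; [reflexivity | specialize (HCP n); lra | apply Hb0].
- intros n. apply pos_INR.
- intros n Hn. apply exponent_ge; assumption.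
- intros n Hn. apply exponent_rec; assumption.
- intros n. fold (Rpower (C * P n) (INR (D * d ^ n))).
  rewrite Rpower_pow by (specialize (HCP n); lra).
  assert (HMs : B + sum_lt (fun k => / Cnorm (alpha (S k))) n <= M).
  { eapply Rle_trans; [|apply Rmax_r]. specialize (Hsum n). unfold y, b in Hsum. lra. }
  assert (L := HL n M HM1 HMs (Hneq n)).
  assert (Hnm : Cnorm (Csub (X1, X2) (Csum_lt (fun n => Cinv (alpha (S n))) n)) <= 2 * T n).
  { eapply Rle_trans; [apply Cnorm_le_abs|]. unfold Csub. simpl.
    rewrite fst_Csum_lt, snd_Csum_lt.
    assert (A1 := sum_lt_tail_le x1 y X1 Y n Hx1 HX1 HY).
    assert (A2 := sum_lt_tail_le x2 y X2 Y n Hx2 HX2 HY).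
    unfold x1, x2 in A1, A2. unfold T. lra. }
  fold b in L. fold P in L.
  assert (Hk1 : (1 <= D * d ^ n)%nat).
  { assert (d ^ n <> 0)%nat by (apply Nat.pow_nonzero; lia). nia. }
  set (K := (D * d ^ n)%nat) in *.
  assert (H1 := HcMP n).
  assert (H2 : 2 * (c * M * P n) ^ K <= (C * P n) ^ K).
  { replace (C * P n) with (2 * (c * M * P n)) by (unfold C; ring).
    rewrite (Rpow_mult_distr 2). apply Rmult_le_compat_r; [apply pow_le; lra|].
    rewrite <- (pow_1 2) at 1. apply Rle_pow; [lra | exact Hk1]. }
  assert (H3 : 0 < (c * M * P n) ^ K) by (apply pow_lt; lra).
  assert (HT : 0 <= T n) by (specialize (Hsum n); unfold T; lra).
  nra.
- intros K N.
  (* With [exp K] as the bound, taking logarithms turns the condition on roots into K E_n < ln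
     |alpha_n|; [S N] accounts for the index shift in [b]. *)
  destruct (Hlimsup (fun n => Cnorm (alpha n)) Hhouse (exp K) (S N)) as [n [Hn [Hn1 H]]].
  destruct n as [|n]; [lia|]. exists n. split; [lia|].
  unfold Rpower in H. apply exp_lt_inv in H.
  assert (HF := exponent_ge d D (S n) Hd HD Hn1).
  assert (0 < 2 ^ (S n - 1)) by (apply pow_lt; lra).
  apply Rmult_lt_reg_l with (/ INR (D ^ S n * prodterm d (S n)));
    [apply Rinv_0_lt_compat; lra|].
  replace (/ INR (D ^ S n * prodterm d (S n)) * (K * INR (D ^ S n * prodterm d (S n))))
    with K by (field; lra). exact H.
Qed.
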